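(* For each non-zero homogeneous quadratic vector field $Q=(Q_1,Q_2)$ on the plane and each $\lambda\neq0$, there exist a linear change of coordinates and an orientation preserving reparametrisation of time that transform the system $\dot x=\lambda x+Q_1(x,y)$, $\dot y=\lambda y+Q_2(x,y)$ into only one of the following canonical forms, where $q_1,q_2\in\mathbb R$ and $\tilde\lambda$ and $\lambda$ have the same sign: (i) $\dot x=\tilde\lambda x+q_1x^2+q_2xy-y^2$, $\ \dot y=\tilde\lambda y+x^2+q_1xy+q_2y^2$, with $\mathcal G(x,y)=x^3+y^3$ and $\mathcal F(x,y)=q_1x^3+(q_2+1)x^2y+(q_1-1)xy^2+q_2y^3$; (ii) $\dot x=\tilde\lambda x+q_1x^2+(q_2+3)xy$, $\ \dot y=\tilde\lambda y+x^2+q_1xy+q_2y^2$, with $\mathcal G(x,y)=x(x^2-3y^2)$ and $\mathcal F(x,y)=q_1x^3+(q_2+4)x^2y+q_1xy^2+q_2y^3$; (iii) $\dot x=\tilde\lambda x+q_1x^2+q_2xy$, $\ \dot y=\tilde\lambda y+(q_1+3)xy+q_2y^2$, with $\mathcal G(x,y)=3x^2y$ and $\mathcal F(x,y)=q_1x^3+q_2x^2y+(q_1+3)xy^2+q_2y^3$; (iv) $\dot x=\tilde\lambda x+q_1x^2+q_2xy$, $\ \dot y=\tilde\lambda y+x^2+q_1xy+q_2y^2$, with $\mathcal G(x,y)=x^3$ and $\mathcal F(x,y)=q_1x^3+(q_2+1)x^2y+q_1xy^2+q_2y^3$; (v) $\dot x=\tilde\lambda x+q_1x^2+q_2xy$,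 $\ \dot y=\tilde\lambda y+q_1xy+q_2y^2$, with $\mathcal G(x,y)=0$ and $\mathcal F(x,y)=q_1x^3+q_2x^2y+q_1xy^2+q_2y^3$. For $\lambda>0$ these canonical forms give rise to a minimum of 16 qualitatively different phase portraits (i.e. at least 16 topological equivalence classes on the Poincaré disk).
   Context: For a homogeneous vector field $Q=(Q_1,Q_2)$, $\mathcal G(x,y)=xQ_2(x,y)-yQ_1(x,y)$ and $\mathcal F(x,y)=xQ_1(x,y)+yQ_2(x,y)$; in (i)–(v) they are computed for the nonlinear part of the canonical form. The Poincaré disk is the compactification of $\mathbb R^2$ by the circle at infinity, to which the (time-rescaled) polynomial vector field extends (Poincaré compactification). Two systems are topologically equivalent (have the same phase portrait) if there is a homeomorphism of the Poincaré disk mapping trajectories of one system into trajectories of the other and preserving time orientation. *)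

(* Defs.v *)
From Stdlib Require Import Reals Lra.
From Coquelicot Require Import Coquelicot.
Open Scope R_scope.

(** * Planar vector fields *)

Definition homogeneous_quadratic (Q : R * R -> R * R) : Prop :=
  exists a b c a' b' c' : R, forall x y : R,
    Q (x, y) = (a * x ^ 2 + b * x * y + c * y ^ 2,
                a' * x ^ 2 + b' * x * y + c' * y ^ 2).

Definition nonzero_field (Q : R * R -> R * R) : Prop :=
  exists p : R * R, Q p <> (0, 0).

Definition system (lam : R) (Q : R * R -> R * R) (p : R * R) : R * R :=
  (lam * fst p + fst (Q p), lam * snd p + snd (Q p)).

Definition calG (Q : R * R -> R * R) (x y : R) : R :=
  x * snd (Q (x, y)) - y * fst (Q (x, y)).

Definition calF (Q : R * R -> R * R) (x y : R) : R :=
  x * fst (Q (x, y)) + y * snd (Q (x, y)).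

(** In the coordinates [z = L p], with [L] linear and invertible, and the new
    time [s = t / k], [k > 0], the equation [dp/dt = X p] becomes
    [dz/ds = Y z], where [Y (L p) = k * L (X p)]. *)
Definition linearly_transformable (X Y : R * R -> R * R) : Prop :=
  exists a b c d k : R,
    a * d - b * c <> 0 /\ 0 < k /\
    forall p : R * R,
      Y (a * fst p + b * snd p, c * fst p + d * snd p) =
      (k * (a * fst (X p) + b * snd (X p)),
       k * (c * fst (X p) + d * snd (X p))).

(** * Canonical forms *)

Inductive form : Set := form_i | form_ii | form_iii | form_iv | form_v.

Definition canonical (f : form) (q1 q2 : R) (p : R * R) : R * R :=
  let (x, y) := p in
  match f with
  | form_i => (q1 * x ^ 2 + q2 * x * y - y ^ 2,
               x ^ 2 + q1 * x * y + q2 * y ^ 2)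
  | form_ii => (q1 * x ^ 2 + (q2 + 3) * x * y,
                x ^ 2 + q1 * x * y + q2 * y ^ 2)
  | form_iii => (q1 * x ^ 2 + q2 * x * y,
                 (q1 + 3) * x * y + q2 * y ^ 2)
  | form_iv => (q1 * x ^ 2 + q2 * x * y,
                x ^ 2 + q1 * x * y + q2 * y ^ 2)
  | form_v => (q1 * x ^ 2 + q2 * x * y,
               q1 * x * y + q2 * y ^ 2)
  end.

Definition canonical_G (f : form) (x y : R) : R :=
  match f with
  | form_i => x ^ 3 + y ^ 3
  | form_ii => x * (x ^ 2 - 3 * y ^ 2)
  | form_iii => 3 * x ^ 2 * y
  | form_iv => x ^ 3
  | form_v => 0
  end.

Definition canonical_F (f : form) (q1 q2 x y : R) : R :=
  match f with
  | form_i =>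
      q1 * x ^ 3 + (q2 + 1) * x ^ 2 * y + (q1 - 1) * x * y ^ 2 + q2 * y ^ 3
  | form_ii =>
      q1 * x ^ 3 + (q2 + 4) * x ^ 2 * y + q1 * x * y ^ 2 + q2 * y ^ 3
  | form_iii =>
      q1 * x ^ 3 + q2 * x ^ 2 * y + (q1 + 3) * x * y ^ 2 + q2 * y ^ 3
  | form_iv =>
      q1 * x ^ 3 + (q2 + 1) * x ^ 2 * y + q1 * x * y ^ 2 + q2 * y ^ 3
  | form_v =>
      q1 * x ^ 3 + q2 * x ^ 2 * y + q1 * x * y ^ 2 + q2 * y ^ 3
  end.

(** * Poincaré compactification *)

(** The Poincaré disk, in its standard model: the closed northern hemisphere
    (which the orthogonal projection [(u, v, w) |-> (u, v)] maps
    homeomorphically onto the closed unit disk).  The circle at infinity is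
    [w = 0]. *)
Definition poincare_disk (m : R * R * R) : Prop :=
  let '(u, v, w) := m in u ^ 2 + v ^ 2 + w ^ 2 = 1 /\ 0 <= w.

(** The plane is embedded in the disk by central projection. *)
Definition central_projection (p : R * R) : R * R * R :=
  let (x, y) := p in
  let r := sqrt (1 + x ^ 2 + y ^ 2) in (x / r, y / r, 1 / r).

(** Extension to the disk of [system lam Q], [Q] homogeneous quadratic.  The
    factor [w ^ (d - 1)] which makes the image of a field of degree [d] under
    the central projection extend to [w = 0] is [w], and
    [(W1, W2) = w ^ 2 * system lam Q (u / w, v / w)]; the extended field is the
    tangential part of [(W1, W2, 0)].  See [compactified_field_spec]. *)
Definition compactified_field (lam : R) (Q : R * R -> R * R)
    (m : R * R * R) : R * R * R :=
  let '(u, v, w) := m in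
  let W1 := lam * w * u + fst (Q (u, v)) in
  let W2 := lam * w * v + snd (Q (u, v)) in
  let s := u * W1 + v * W2 in
  (W1 - u * s, W2 - v * s, - w * s).

(** At the image of a finite point [(x, y)], the extended field is [w] times
    the image of the planar field under the derivative of the central
    projection. *)
Lemma compactified_field_spec (lam : R) (Q : R * R -> R * R) (x y : R) :
  homogeneous_quadratic Q ->
  let V := system lam Q (x, y) in
  let curve t := central_projection (x + t * fst V, y + t * snd V) in
  let m := central_projection (x, y) in
  let Z := compactified_field lam Q m in
  is_derive (fun t => fst (fst (curve t))) 0 (fst (fst Z) / snd m) /\
  is_derive (fun t => snd (fst (curve t))) 0 (snd (fst Z) / snd m) /\
  is_derive (fun t => snd (curve t)) 0 (snd Z / snd m).
Proof.
  intros [a [b [c [a' [b' [c' HQ]]]]]].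
  cbv zeta; unfold compactified_field, central_projection, system;
    cbn [fst snd]; rewrite !HQ; cbn [fst snd].
  set (V1 := lam * x + _); set (V2 := lam * y + _).
  assert (Hp : 0 < 1 + x ^ 2 + y ^ 2) by nra.
  set (r := sqrt (1 + x ^ 2 + y ^ 2)).
  assert (Hr : 0 < r) by (apply sqrt_lt_R0; exact Hp).
  assert (Hr2 : r * r = 1 + x ^ 2 + y ^ 2)
    by (unfold r; rewrite sqrt_sqrt; lra).
  assert (Hy : y ^ 2 = r ^ 2 - 1 - x ^ 2) by (simpl in *; lra).
  assert (H0 : sqrt (1 + (x + 0 * V1) ^ 2 + (y + 0 * V2) ^ 2) = r)
    by (unfold r; f_equal; ring).
  assert (E1 : lam * (1 / r) * (x / r)
      + (a * (x / r) ^ 2 + b * (x / r) * (y / r) + c * (y / r) ^ 2)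
      = V1 / r ^ 2) by (unfold V1; field; lra).
  assert (E2 : lam * (1 / r) * (y / r)
      + (a' * (x / r) ^ 2 + b' * (x / r) * (y / r) + c' * (y / r) ^ 2)
      = V2 / r ^ 2) by (unfold V2; field; lra).
  rewrite E1, E2.
  clearbody V1 V2.
  assert (Hd : 0 < 1 + (x + 0 * V1) * ((x + 0 * V1) * 1)
                   + (y + 0 * V2) * ((y + 0 * V2) * 1)) by nra.
  cbn [pow] in H0.
  assert (Hn : r <> 0) by lra.
  split; [|split];
    (auto_derive;
     [ cbn [pow]; rewrite H0; auto
     | cbn [pow]; rewrite ?H0; field_simplify_eq; auto;
       try (replace (r ^ 4) with (r ^ 2 * r ^ 2) by ring);
       replace (r ^ 2) with (1 + x ^ 2 + y ^ 2) by (simpl in *; lra); ring ]).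
Qed.

(** A complete solution on the disk.  The disk is compact and invariant under
    the extended field, so maximal solutions are defined for all times. *)
Definition solution (lam : R) (Q : R * R -> R * R) (g : R -> R * R * R) : Prop :=
  forall t : R,
    poincare_disk (g t) /\
    let Z := compactified_field lam Q (g t) in
    is_derive (fun s => fst (fst (g s))) t (fst (fst Z)) /\
    is_derive (fun s => snd (fst (g s))) t (snd (fst Z)) /\
    is_derive (fun s => snd (g s)) t (snd Z).

(** An oriented trajectory: a complete solution, up to an increasing bijective
    reparametrisation of time. *)
Definition trajectory (lam : R) (Q : R * R -> R * R) (c : R -> R * R * R) : Prop :=
  exists (g : R -> R * R * R) (tau : R -> R),
    solution lam Q g /\
    (forall s t : R, s < t -> tau s < tau t) /\
    (forall r : R, exists t : R, tau t = r) /\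
    forall t : R, c t = g (tau t).

Definition disk_homeomorphism (h : R * R * R -> R * R * R) : Prop :=
  (forall m, poincare_disk m -> poincare_disk (h m)) /\
  continuous_on poincare_disk h /\
  exists h' : R * R * R -> R * R * R,
    (forall m, poincare_disk m -> poincare_disk (h' m)) /\
    continuous_on poincare_disk h' /\
    (forall m, poincare_disk m -> h' (h m) = m) /\
    (forall m, poincare_disk m -> h (h' m) = m).

(** The oriented trajectories of the two systems correspond under [h]. *)
Definition topologically_equivalent
    (lam : R) (Q : R * R -> R * R) (lam' : R) (Q' : R * R -> R * R) : Prop :=
  exists h : R * R * R -> R * R * R,
    disk_homeomorphism h /\
    forall c : R -> R * R * R,
      (forall t, poincare_disk (c t)) ->
      (trajectory lam Q c <-> trajectory lam' Q' (fun t => h (c t))).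

(* Main.v *)
Require Import Defs.
From Stdlib Require Import Reals Ranalysis5 Lra Lia List IndefiniteDescription.
From Coquelicot Require Import Coquelicot.
Import ListNotations.
Open Scope R_scope.

(** Classification.  The determinant of position and velocity of
    [x' = lam x + Q x] is the binary cubic form [calG Q], and a linear change of
    coordinates with a change of time replaces it by an equivalent cubic form up
    to a factor ([transformable_calG_similar]).  Conversely [calG Q] determines
    [Q] up to a multiple of the position by a linear form, which is what [q1] and
    [q2] parametrise ([similar_calG_transformable]).  So the canonical forms
    correspond to the classes of real binary cubic forms: a simple real zero line
    with two complex ones, three real lines, a double and a simple line, a triple
    line, and zero.  Existence is [cubic_classification]; uniqueness is
    [canonical_G_similar_inj], by the sign of the discriminant.

    Portraits.  The zeros [d] of [calG] on the unit circle are the equilibria at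
    infinity; the ray in such a direction is invariant and carries a further
    equilibrium exactly if [radial Q d < 0].  This gives the number of equilibria
    ([cardinal_equilibria]).  The number of sources, the equilibria to which no
    other equilibrium is connected by a trajectory, is also a topological
    invariant, and is found without the global phase portrait.  The origin is a
    source, by monotonicity of the height.  The trajectory along a ray leads from
    the origin to a finite equilibrium, and to the point at infinity if
    [radial Q d >= 0].  If [radial Q d < 0], the point at infinity can be reached
    only along the circle at infinity, and then it is a source exactly if it
    repels there ([sources]).  All trajectories that have to be exhibited lie on
    rays or in the circle at infinity, hence they come from scalar autonomous
    equations ([scalar_orbit]).

    Fifteen fields with finitely many equilibria and one with infinitely many are
    distinguished by these two numbers, except for two fields of [form_iii],
    which [branching] separates: in one of them an equilibrium that no source is
    connected to is entered from two different equilibria. *)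

(** * Binary cubic forms *)

Definition cubic (A B C D x y : R) : R :=
  A * x ^ 3 + B * x ^ 2 * y + C * x * y ^ 2 + D * y ^ 3.

Lemma cubic_coefficients (A B C D A' B' C' D' : R) :
  (forall x y, cubic A B C D x y = cubic A' B' C' D' x y) ->
  A = A' /\ B = B' /\ C = C' /\ D = D'.
Proof.
  unfold cubic; intros H.
  generalize (H 1 0) (H 0 1) (H 1 1) (H 1 (-1)); intros; lra.
Qed.

(** Equivalence under linear substitutions up to a constant factor: the relation
    that linear changes of coordinates and of time induce on [calG]. *)
Definition cubic_similar (g g' : R -> R -> R) : Prop :=
  exists a b c d kappa : R,
    a * d - b * c <> 0 /\ kappa <> 0 /\
    forall x y, g' (a * x + b * y) (c * x + d * y) = kappa * g x y.

Lemma cubic_similar_trans (g1 g2 g3 : R -> R -> R) :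
  cubic_similar g1 g2 -> cubic_similar g2 g3 -> cubic_similar g1 g3.
Proof.
  intros (a & b & c & d & k & Hdet & Hk & H)
         (a' & b' & c' & d' & k' & Hdet' & Hk' & H').
  exists (a' * a + b' * c), (a' * b + b' * d),
         (c' * a + d' * c), (c' * b + d' * d), (k' * k).
  split; [|split].
  - replace (_ - _) with ((a' * d' - b' * c') * (a * d - b * c)) by ring.
    now apply Rmult_integral_contrapositive.
  - now apply Rmult_integral_contrapositive.
  - intros x y.
    rewrite Rmult_assoc, <- H, <- H'; f_equal; ring.
Qed.

Lemma cubic_similar_sym (g g' : R -> R -> R) :
  cubic_similar g g' -> cubic_similar g' g.
Proof.
  intros (a & b & c & d & k & Hdet & Hk & H).
  set (D := a * d - b * c) in *.
  exists (d / D), (- b / D), (- c / D), (a / D), (/ k).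
  split; [|split].
  - replace (_ - _) with (/ D) by (unfold D; field; exact Hdet).
    now apply Rinv_neq_0_compat.
  - now apply Rinv_neq_0_compat.
  - intros x y.
    replace (g' x y) with
      (g' (a * (d / D * x + - b / D * y) + b * (- c / D * x + a / D * y))
          (c * (d / D * x + - b / D * y) + d * (- c / D * x + a / D * y)))
      by (f_equal; unfold D; field; exact Hdet).
    rewrite H; field; exact Hk.
Qed.

Lemma cubic_similar_substitution (g g' : R -> R -> R) (a b c d : R) :
  a * d - b * c <> 0 ->
  (forall x y, g' (a * x + b * y) (c * x + d * y) = g x y) ->
  cubic_similar g g'.
Proof.
  intros Hdet H; exists a, b, c, d, 1.
  repeat split; [exact Hdet | lra | intros; rewrite H; ring].
Qed.

Definition discriminant (A B C D : R) : R :=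
  B ^ 2 * C ^ 2 - 4 * A * C ^ 3 - 4 * B ^ 3 * D + 18 * A * B * C * D
  - 27 * A ^ 2 * D ^ 2.

(** The discriminant is an invariant of weight 6 of binary cubic forms, so that
    its sign survives linear substitutions. *)
Lemma discriminant_similar (A B C D A' B' C' D' : R) :
  cubic_similar (cubic A B C D) (cubic A' B' C' D') ->
  exists e, 0 < e /\ discriminant A B C D = e * discriminant A' B' C' D'.
Proof.
  intros (a & b & c & d & k & Hdet & Hk & H).
  destruct (cubic_coefficients
    (cubic A' B' C' D' a c)
    (3 * A' * a ^ 2 * b + B' * (a ^ 2 * d + 2 * a * b * c)
     + C' * (2 * a * c * d + b * c ^ 2) + 3 * D' * c ^ 2 * d)
    (3 * A' * a * b ^ 2 + B' * (2 * a * b * d + b ^ 2 * c)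
     + C' * (a * d ^ 2 + 2 * b * c * d) + 3 * D' * c * d ^ 2)
    (cubic A' B' C' D' b d)
    (k * A) (k * B) (k * C) (k * D)) as (E1 & E2 & E3 & E4).
  { intros x y; specialize (H x y); unfold cubic in *; lra. }
  exists (((a * d - b * c) ^ 3) ^ 2 / (k ^ 2) ^ 2); split.
  - apply Rdiv_lt_0_compat; rewrite <- Rsqr_pow2; apply Rsqr_pos_lt;
      now apply pow_nonzero.
  - apply Rmult_eq_reg_l with (k ^ 4); [|now apply pow_nonzero].
    transitivity (discriminant (k * A) (k * B) (k * C) (k * D));
      [unfold discriminant; ring|].
    rewrite <- E1, <- E2, <- E3, <- E4.
    unfold discriminant, cubic; field; exact Hk.
Qed.

(** A real cubic form vanishes on some line, by the intermediate value theorem;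
    in coordinates in which this line is [x = 0], it is divisible by [x]. *)
Lemma cubic_has_linear_factor (A B C D : R) :
  exists A' B' C' : R, cubic_similar (cubic A B C D) (cubic A' B' C' 0).
Proof.
  destruct (Req_dec D 0) as [->|HD].
  { exists A, B, C; apply (cubic_similar_substitution _ _ 1 0 0 1);
      [lra | intros; unfold cubic; ring]. }
  assert (Hroot : exists z, cubic A B C D 1 z = 0).
  { (* [w = D * z] is a root of a monic cubic polynomial [p]; at distance [N]
       from [0] its leading term outweighs the others. *)
    set (N := 1 + Rabs (A * D ^ 2) + Rabs (B * D) + Rabs C).
    set (p := fun w => w ^ 3 + C * w ^ 2 + B * D * w + A * D ^ 2).
    assert (HN : 1 <= N)
      by (unfold N; generalize (Rabs_pos (A * D ^ 2)) (Rabs_pos (B * D)) (Rabs_pos C); lra).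
    assert (HNp : 0 < p N /\ p (- N) < 0).
    { unfold p.
      assert (H1 := Rle_abs (A * D ^ 2)). assert (H1' := Rle_abs (- (A * D ^ 2))).
      assert (H2 := Rle_abs (B * D)). assert (H2' := Rle_abs (- (B * D))).
      assert (H3 := Rle_abs C). assert (H3' := Rle_abs (- C)).
      rewrite Rabs_Ropp in H1', H2', H3'.
      set (a := Rabs (A * D ^ 2)) in *. set (b := Rabs (B * D)) in *.
      set (c := Rabs C) in *.
      assert (HNe : N = 1 + a + b + c) by reflexivity.
      clearbody N.
      assert (HN2 : N <= N ^ 2) by nra.
      assert (a <= a * N ^ 2) by (assert (0 <= a) by apply Rabs_pos; nra).
      assert (b * N <= b * N ^ 2) by (assert (0 <= b) by apply Rabs_pos; nra).
      assert (HE : N ^ 3 = N ^ 2 + a * N ^ 2 + b * N ^ 2 + c * N ^ 2)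
        by (transitivity ((1 + a + b + c) * N ^ 2); [rewrite <- HNe|]; ring).
      assert (- c * N ^ 2 <= C * N ^ 2 <= c * N ^ 2) by (split; nra).
      assert (- b * N <= B * D * N <= b * N) by (split; nra).
      split; nra. }
    destruct (IVT p (- N) N) as (w & _ & Hw); try lra.
    { unfold p; intros x; apply derivable_continuous_pt; reg. }
    exists (w / D); unfold p in Hw; unfold cubic.
    apply Rmult_eq_reg_l with (D ^ 2); [|now apply pow_nonzero].
    rewrite Rmult_0_r, <- Hw; field; exact HD. }
  destruct Hroot as [z Hz].
  (* The line [y = z x] becomes the axis [x = 0] of the new coordinates. *)
  exists D, (C + 3 * D * z), (B + 2 * C * z + 3 * D * z ^ 2).
  apply (cubic_similar_substitution _ _ (- z) 1 1 0); [lra|].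
  intros x y; unfold cubic in *.
  assert (HA : A = - B * z - C * z ^ 2 - D * z ^ 3) by lra.
  rewrite HA; ring.
Qed.

(** Dividing by a linear factor [x] leaves a binary quadratic form, and
    completing the square there leaves only the sign of its discriminant and
    its position relative to [x]. *)
Lemma cubic_classification (A B C D : R) :
  exists f : form, cubic_similar (cubic A B C D) (canonical_G f).
Proof.
  destruct (cubic_has_linear_factor A B C D) as (A' & B' & C' & HS).
  cut (exists f, cubic_similar (cubic A' B' C' 0) (canonical_G f)).
  { intros [f Hf]; exists f; eapply cubic_similar_trans; eassumption. }
  clear A B C D HS; rename A' into A, B' into B, C' into C.
  destruct (Req_dec C 0) as [->|HC].
  - destruct (Req_dec B 0) as [->|HB].
    + destruct (Req_dec A 0) as [->|HA].
      * exists form_v; apply (cubic_similar_substitution _ _ 1 0 0 1);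
          [lra | intros; unfold cubic; simpl; ring].
      * exists form_iv; exists 1, 0, 0, 1, (/ A).
        repeat split; [lra | now apply Rinv_neq_0_compat |].
        intros; unfold cubic; simpl; field; exact HA.
    + exists form_iii; apply (cubic_similar_substitution _ _ 1 0 (A / 3) (B / 3)).
      * lra.
      * intros; unfold cubic; simpl; field.
  - set (E := A - B ^ 2 / (4 * C)).
    destruct (Rtotal_order (E * C) 0) as [H|[H|H]].
    + (* [g = E x (x ^ 2 - 3 Y ^ 2)] with [Y = s (y + B / (2 C) x)] *)
      assert (HE : E <> 0) by (intros HE; rewrite HE in H; lra).
      assert (Hr : 0 < - C / (3 * E)).
      { replace (- C / (3 * E)) with (- (E * C) * / (3 * (E * E)))
          by (field; exact HE).
        apply Rmult_lt_0_compat; [lra|]. apply Rinv_0_lt_compat; nra. }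
      set (s := sqrt (- C / (3 * E))).
      assert (Hs : 0 < s) by now apply sqrt_lt_R0.
      assert (Hs2 : s ^ 2 = - C / (3 * E)) by (apply pow2_sqrt; lra).
      exists form_ii, 1, 0, (s * B / (2 * C)), s, (/ E).
      repeat split; [lra | now apply Rinv_neq_0_compat |].
      intros; unfold cubic; simpl canonical_G.
      replace (_ * _) with
        (x * (x ^ 2 - 3 * (s ^ 2 * (y + B / (2 * C) * x) ^ 2)))
        by (field; exact HC).
      rewrite Hs2.
      replace A with (E + B ^ 2 / (4 * C)) by (unfold E; ring).
      field; auto.
    + assert (HE : E = 0) by (apply Rmult_integral in H; tauto).
      exists form_iii.
      exists (B / (2 * C)), 1, 1, 0, (3 / C).
      repeat split; [lra | |].
      * intros H0; apply (Rmult_eq_compat_r C) in H0; field_simplify in H0; lra.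
      * intros; unfold cubic; simpl canonical_G.
        replace A with (E + B ^ 2 / (4 * C)) by (unfold E; ring).
        rewrite HE; field; exact HC.
    + (* [u ^ 3 + v ^ 3 = x (x ^ 2 + 3 Y ^ 2) / 4] with
         [u = (x + Y) / 2], [v = (x - Y) / 2] *)
      assert (HE : E <> 0) by (intros HE; rewrite HE in H; lra).
      assert (Hr : 0 < C / (3 * E)).
      { replace (C / (3 * E)) with ((E * C) * / (3 * (E * E)))
          by (field; exact HE).
        apply Rmult_lt_0_compat; [lra|]. apply Rinv_0_lt_compat; nra. }
      set (s := sqrt (C / (3 * E))).
      assert (Hs : 0 < s) by now apply sqrt_lt_R0.
      assert (Hs2 : s ^ 2 = C / (3 * E)) by (apply pow2_sqrt; lra).
      set (t := s * B / (2 * C)).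
      exists form_i, ((1 + t) / 2), (s / 2), ((1 - t) / 2), (- s / 2), (/ (4 * E)).
      repeat split; [lra | apply Rinv_neq_0_compat; lra |].
      intros; unfold cubic; simpl canonical_G.
      replace (_ + _) with
        (x * (x ^ 2 + 3 * (s ^ 2 * (y + B / (2 * C) * x) ^ 2)) / 4)
        by (unfold t; field; exact HC).
      rewrite Hs2.
      replace A with (E + B ^ 2 / (4 * C)) by (unfold E; ring).
      field; auto.
Qed.

(** The sign of the discriminant separates the cubic forms with one, with three
    and with multiple real zero lines; among the latter, [x ^ 3] is a cube,
    [3 x ^ 2 y] is not, and [0] is similar to nothing else. *)
Lemma canonical_G_similar_inj (f f' : form) :
  cubic_similar (canonical_G f) (canonical_G f') -> f = f'.
Proof.
  set (coeffs := fun f => match f with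
    | form_i => (1, 0, 0, 1) | form_ii => (1, 0, -3, 0)
    | form_iii => (0, 3, 0, 0) | form_iv => (1, 0, 0, 0)
    | form_v => (0, 0, 0, 0) end).
  assert (Hdisc : cubic_similar (canonical_G f) (canonical_G f') ->
    let '(A, B, C, D) := coeffs f in let '(A', B', C', D') := coeffs f' in
    exists e, 0 < e /\ discriminant A B C D = e * discriminant A' B' C' D').
  { destruct f, f'; intros H; apply discriminant_similar;
      destruct H as (a & b & c & d & k & Hdet & Hk & H);
      exists a, b, c, d, k; repeat split; auto; intros x y;
      specialize (H x y); unfold cubic; simpl in *; lra. }
  assert (H34 : ~ cubic_similar (canonical_G form_iii) (canonical_G form_iv)).
  { intros (a & b & c & d & k & Hdet & Hk & H); simpl in H.
    destruct (Req_dec a 0) as [->|Ha]; [|apply (pow_nonzero a 3 Ha)].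
    destruct (Req_dec b 0) as [->|Hb]; [lra|apply (pow_nonzero b 3 Hb)].
    - generalize (H 0 1); simpl; intros; nra.
    - generalize (H 1 0); simpl; intros; nra. }
  assert (H35 : ~ cubic_similar (canonical_G form_iii) (canonical_G form_v)).
  { intros (a & b & c & d & k & Hdet & Hk & H); simpl in H.
    generalize (H 1 1); lra. }
  assert (H45 : ~ cubic_similar (canonical_G form_iv) (canonical_G form_v)).
  { intros (a & b & c & d & k & Hdet & Hk & H); simpl in H.
    generalize (H 1 1); lra. }
  intros H; assert (H' := cubic_similar_sym _ _ H).
  generalize (Hdisc H); clear Hdisc.
  destruct f, f'; try reflexivity; try tauto;
    intros (e & He & E); exfalso; unfold discriminant in E; lra.
Qed.

(** * Linear changes of coordinates *)

(** The determinant of a point and its velocity is [calG]: scalar linear parts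
    drop out of it, and linear maps multiply it by a constant. *)
Lemma transformable_calG_similar (Q Q' : R * R -> R * R) (lam lam' : R) :
  linearly_transformable (system lam Q) (system lam' Q') ->
  cubic_similar (calG Q) (calG Q').
Proof.
  intros (a & b & c & d & k & Hdet & Hk & H).
  exists a, b, c, d, (k * (a * d - b * c)).
  split; [exact Hdet|split].
  { apply Rmult_integral_contrapositive; split; lra. }
  intros x y; specialize (H (x, y)).
  unfold system in H; simpl in H; injection H as H1 H2.
  unfold calG.
  destruct (Q (x, y)) as [u v], (Q' (a * x + b * y, c * x + d * y)) as [u' v'].
  simpl in *.
  replace u' with (k * (a * (lam * x + u) + b * (lam * y + v))
                   - lam' * (a * x + b * y)) by lra.
  replace v' with (k * (c * (lam * x + u) + d * (lam * y + v))
                   - lam' * (c * x + d * y)) by lra.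
  ring.
Qed.

Lemma calG_canonical (f : form) (q1 q2 x y : R) :
  calG (canonical f q1 q2) x y = canonical_G f x y.
Proof. destruct f; unfold calG; simpl; ring. Qed.

Lemma calF_canonical (f : form) (q1 q2 x y : R) :
  calF (canonical f q1 q2) x y = canonical_F f q1 q2 x y.
Proof. destruct f; unfold calF; simpl; ring. Qed.

(** A homogeneous quadratic field is determined by [calG] up to a field
    [(x, y) |-> (q1 x + q2 y) (x, y)]; the families of canonical forms are closed
    under adding such a field. *)
Lemma canonical_of_calG (f : form) (a b c a' b' c' : R) :
  (forall x y, x * (a' * x ^ 2 + b' * x * y + c' * y ^ 2)
               - y * (a * x ^ 2 + b * x * y + c * y ^ 2) = canonical_G f x y) ->
  exists q1 q2, forall x y,
    canonical f q1 q2 (x, y) =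
    (a * x ^ 2 + b * x * y + c * y ^ 2, a' * x ^ 2 + b' * x * y + c' * y ^ 2).
Proof.
  intros H.
  assert (H1 := H 1 0). assert (H2 := H 0 1).
  assert (H3 := H 1 1). assert (H4 := H 1 (-1)).
  destruct f; simpl in H1, H2, H3, H4.
  1: exists a, c'. 2: exists a, c'. 3: exists a, c'. 4: exists a, c'. 5: exists a, c'.
  all: intros x y; simpl; f_equal.
  all: ring_simplify in H1; ring_simplify in H2; ring_simplify in H3; ring_simplify in H4.
  - replace c with (-1) by lra; replace b with c' by lra; ring.
  - replace a' with 1 by lra; replace b' with a by lra; ring.
  - replace c with 0 by lra; replace b with (c' + 3) by lra; ring.
  - replace a' with 1 by lra; replace b' with a by lra; ring.
  - replace c with 0 by lra; replace b with c' by lra; ring.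
  - replace a' with 0 by lra; replace b' with (a + 3) by lra; ring.
  - replace c with 0 by lra; replace b with c' by lra; ring.
  - replace a' with 1 by lra; replace b' with a by lra; ring.
  - replace c with 0 by lra; replace b with c' by lra; ring.
  - replace a' with 0 by lra; replace b' with a by lra; ring.
Qed.

(** A similarity of cubic forms carries [Q] to a canonical form, without change
    of time: rescaling the linear map by [1 / mu] multiplies cubic forms by
    [1 / mu ^ 3], but [calG] transforms with the determinant, hence by
    [1 / mu ^ 2] only, so that any constant can be absorbed. *)
Lemma similar_calG_transformable (f : form) (Q : R * R -> R * R) (lam : R) :
  homogeneous_quadratic Q -> cubic_similar (calG Q) (canonical_G f) ->
  exists q1 q2,
    linearly_transformable (system lam Q) (system lam (canonical f q1 q2)).
Proof.
  intros (q & r & s & q' & r' & s' & HQ) (a & b & c & d & k & Hdet & Hk & H).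
  set (D := a * d - b * c) in *.
  (* [mu ^ 3 * k = mu ^ 2 * D] *)
  set (mu := D / k).
  assert (Hmu : mu <> 0)
    by (apply Rmult_integral_contrapositive; split;
        [exact Hdet | now apply Rinv_neq_0_compat]).
  assert (HG : forall x y,
    canonical_G f (mu * a * x + mu * b * y) (mu * c * x + mu * d * y)
    = mu ^ 3 * k * calG Q x y).
  { intros x y; rewrite (Rmult_assoc _ k), <- H; destruct f; simpl; ring. }
  assert (HGk : mu ^ 3 * k = mu ^ 2 * D) by (unfold mu; field; exact Hk).
  rewrite HGk in HG; clear H HGk.
  set (a1 := mu * a) in *. set (b1 := mu * b) in *.
  set (c1 := mu * c) in *. set (d1 := mu * d) in *.
  set (D1 := a1 * d1 - b1 * c1).
  assert (HD1 : mu ^ 2 * D = D1) by (unfold D1, D, a1, b1, c1, d1; ring).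
  rewrite HD1 in HG.
  assert (HD : D1 <> 0).
  { rewrite <- HD1; apply Rmult_integral_contrapositive; split;
      [now apply pow_nonzero | exact Hdet]. }
  clearbody a1 b1 c1 d1. clear HD1 Hdet D mu Hmu Hk.
  (* [P q r s] is a component of [Q o L ^ -1] *)
  set (P := fun q r s x y => (q * (d1 * x - b1 * y) ^ 2
     + r * (d1 * x - b1 * y) * (a1 * y - c1 * x) + s * (a1 * y - c1 * x) ^ 2) / D1 ^ 2).
  assert (HP : forall q r s x y, P q r s x y =
     (q * d1 ^ 2 - r * d1 * c1 + s * c1 ^ 2) / D1 ^ 2 * x ^ 2
     + (- 2 * q * d1 * b1 + r * (d1 * a1 + b1 * c1) - 2 * s * a1 * c1) / D1 ^ 2 * x * y
     + (q * b1 ^ 2 - r * b1 * a1 + s * a1 ^ 2) / D1 ^ 2 * y ^ 2)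
    by (intros; unfold P; field; exact HD).
  set (A := fun q r s => (q * d1 ^ 2 - r * d1 * c1 + s * c1 ^ 2) / D1 ^ 2) in *.
  set (B := fun q r s =>
    (- 2 * q * d1 * b1 + r * (d1 * a1 + b1 * c1) - 2 * s * a1 * c1) / D1 ^ 2) in *.
  set (C := fun q r s => (q * b1 ^ 2 - r * b1 * a1 + s * a1 ^ 2) / D1 ^ 2) in *.
  assert (HPL : forall q r s x y,
    P q r s (a1 * x + b1 * y) (c1 * x + d1 * y) = q * x ^ 2 + r * x * y + s * y ^ 2)
    by (intros; unfold P, D1; field; exact HD).
  assert (HP' : forall q r s x y,
    P q r s x y = A q r s * x ^ 2 + B q r s * x * y + C q r s * y ^ 2)
    by exact HP.
  clear HP; clearbody A B C.
  destruct (canonical_of_calG f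
    (a1 * A q r s + b1 * A q' r' s') (a1 * B q r s + b1 * B q' r' s')
    (a1 * C q r s + b1 * C q' r' s')
    (c1 * A q r s + d1 * A q' r' s') (c1 * B q r s + d1 * B q' r' s')
    (c1 * C q r s + d1 * C q' r' s')) as (q1 & q2 & Hc).
  { intros x y.
    set (x0 := (d1 * x - b1 * y) / D1). set (y0 := (a1 * y - c1 * x) / D1).
    replace x with (a1 * x0 + b1 * y0) by (unfold x0, y0, D1; field; exact HD).
    replace y with (c1 * x0 + d1 * y0) by (unfold x0, y0, D1; field; exact HD).
    rewrite HG; unfold calG; rewrite HQ; cbn [fst snd].
    rewrite <- (HPL q r s x0 y0), <- (HPL q' r' s' x0 y0).
    set (x1 := a1 * x0 + b1 * y0). set (y1 := c1 * x0 + d1 * y0).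
    replace (D1 * _) with
      (x1 * (c1 * P q r s x1 y1 + d1 * P q' r' s' x1 y1)
       - y1 * (a1 * P q r s x1 y1 + b1 * P q' r' s' x1 y1))
      by (unfold D1, x1, y1; ring).
    rewrite !HP'; ring. }
  exists q1, q2, a1, b1, c1, d1, 1.
  split; [exact HD|split; [lra|]].
  intros [x y]; unfold system; rewrite HQ; cbn [fst snd]; rewrite Hc.
  rewrite <- (HPL q r s x y), <- (HPL q' r' s' x y), !HP'.
  cbn [fst snd]; f_equal; ring.
Qed.

Lemma calG_cubic (Q : R * R -> R * R) :
  homogeneous_quadratic Q ->
  exists A B C D, forall x y, calG Q x y = cubic A B C D x y.
Proof.
  intros (a & b & c & a' & b' & c' & HQ).
  exists a', (b' - a), (c' - b), (- c); intros x y.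
  unfold calG; rewrite HQ; unfold cubic; simpl; ring.
Qed.

Lemma canonical_form_exists_unique (Q : R * R -> R * R) (lam : R) :
  homogeneous_quadratic Q -> lam <> 0 ->
  exists! f : form,
    exists q1 q2 lam' : R,
      0 < lam' * lam /\
      linearly_transformable (system lam Q)
                             (system lam' (canonical f q1 q2)).
Proof.
  intros HQ Hlam.
  destruct (calG_cubic Q HQ) as (A & B & C & D & HG).
  destruct (cubic_classification A B C D) as [f Hf].
  exists f; split.
  - destruct (similar_calG_transformable f Q lam HQ) as (q1 & q2 & H).
    { destruct Hf as (a & b & c & d & k & Hdet & Hk & Hf).
      exists a, b, c, d, k; repeat split; auto; intros; rewrite HG; apply Hf. }
    exists q1, q2, lam; split; [nra | exact H].
  - intros f' (q1 & q2 & lam' & _ & H).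
    apply transformable_calG_similar in H.
    apply canonical_G_similar_inj.
    apply cubic_similar_trans with (cubic A B C D); [now apply cubic_similar_sym|].
    destruct H as (a & b & c & d & k & Hdet & Hk & H).
    exists a, b, c, d, k; repeat split; auto; intros.
    rewrite <- HG, <- H; symmetry; apply calG_canonical.
Qed.

(** * Scalar autonomous equations *)

Definition lipschitz (K : R) (f : R -> R) : Prop :=
  forall x y, Rabs (f x - f y) <= K * Rabs (x - y).

Lemma lipschitz_continuous (K : R) (f : R -> R) (x : R) :
  0 < K -> lipschitz K f -> continuous f x.
Proof.
  intros HK H; apply continuity_pt_filterlim.
  intros e He; exists (e / K); split; [now apply Rdiv_lt_0_compat|].
  intros y [_ Hy]; simpl in *; unfold R_dist in *.
  apply Rle_lt_trans with (1 := H y x).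
  apply Rmult_lt_compat_l with (r := K) in Hy; [|exact HK].
  now replace (K * (e / K)) with e in Hy by (field; lra).
Qed.

Lemma is_derive_of_quadratic_remainder (g : R -> R) (t l C : R) :
  0 <= C -> (forall s, Rabs (g s - g t - l * (s - t)) <= C * (s - t) ^ 2) ->
  is_derive g t l.
Proof.
  intros HC H; apply is_derive_Reals; intros e He.
  assert (Hd : 0 < e / (C + 1)) by (apply Rdiv_lt_0_compat; lra).
  exists (mkposreal _ Hd); simpl; intros h Hh Hlt.
  assert (Ha : 0 < Rabs h) by now apply Rabs_pos_lt.
  specialize (H (t + h)); replace (t + h - t) with h in H by ring.
  replace ((g (t + h) - g t) / h - l) with ((g (t + h) - g t - l * h) / h)
    by (field; exact Hh).
  unfold Rdiv; rewrite Rabs_mult, Rabs_inv.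
  apply Rmult_lt_reg_r with (Rabs h); [exact Ha|].
  rewrite Rmult_assoc, Rinv_l, Rmult_1_r by lra.
  apply Rle_lt_trans with (1 := H).
  rewrite <- (pow2_abs h).
  replace (C * Rabs h ^ 2) with (C * Rabs h * Rabs h) by ring.
  apply Rmult_lt_compat_r; [exact Ha|].
  apply Rmult_lt_compat_r with (r := C + 1) in Hlt; [|lra].
  replace (e / (C + 1) * (C + 1)) with e in Hlt by (field; lra).
  nra.
Qed.

Lemma increment_between (f df : R -> R) (a b x y : R) :
  (forall z, a < z < b -> is_derive f z (df z)) -> a < x < b -> a < y < b ->
  exists c, Rmin x y <= c <= Rmax x y /\ a < c < b /\
            f y - f x = df c * (y - x).
Proof.
  intros Hf Hx Hy.
  assert (Hin : forall c, Rmin x y <= c <= Rmax x y -> a < c < b).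
  { intros c Hc; split.
    - apply Rlt_le_trans with (Rmin x y); [|tauto]; now apply Rmin_glb_lt.
    - apply Rle_lt_trans with (Rmax x y); [tauto|]; now apply Rmax_lub_lt. }
  destruct (MVT_gen f x y df) as (c & Hc & E).
  - intros z Hz; apply Hf, Hin; lra.
  - intros z Hz; apply derivable_continuous_pt; exists (df z).
    apply is_derive_Reals, Hf, Hin, Hz.
  - exists c; auto.
Qed.

(** Between two consecutive zeros [a < b] of [f], the equation [x' = f x] is
    solved by the inverse function of a primitive [T] of [1 / f].  As [f] grows
    at most linearly from its zeros, [T] dominates a logarithm near both ends:
    it is onto [R], the solution lives for all times, and it takes infinite
    time to reach [a] and [b]. *)
Lemma scalar_orbit (f : R -> R) (a b K : R) :
  a < b -> 0 < K -> lipschitz K f -> f a = 0 -> f b = 0 ->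
  (forall x, a < x < b -> 0 < f x) ->
  exists g : R -> R,
    (forall t, a < g t < b) /\
    (forall t, is_derive g t (f (g t))) /\
    filterlim g (Rbar_locally m_infty) (locally a) /\
    filterlim g (Rbar_locally p_infty) (locally b).
Proof.
  intros Hab HK Hf Ha Hb Hpos.
  set (x0 := (a + b) / 2).
  assert (Hx0 : a < x0 < b) by (unfold x0; lra).
  set (T := fun x : R => RInt (V := R_CompleteNormedModule) (fun y => / f y) x0 x).
  assert (HT : forall x, a < x < b -> is_derive T x (/ f x)).
  { intros x Hx; apply (is_derive_RInt (fun y => / f y) T x0 x).
    - assert (Hd : 0 < Rmin (x - a) (b - x)) by (apply Rmin_glb_lt; lra).
      exists (mkposreal _ Hd); intros y Hy.
      apply Rabs_lt_between in Hy; simpl in Hy.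
      unfold minus, plus, opp in Hy; simpl in Hy.
      generalize (Rmin_l (x - a) (b - x)) (Rmin_r (x - a) (b - x)); intros.
      apply (RInt_correct (V := R_CompleteNormedModule)), (ex_RInt_continuous (V := R_CompleteNormedModule)).
      intros z Hz.
      assert (a < z < b).
      { split.
        - apply Rlt_le_trans with (Rmin x0 y); [|tauto].
          apply Rmin_glb_lt; lra.
        - apply Rle_lt_trans with (Rmax x0 y); [tauto|].
          apply Rmax_lub_lt; lra. }
      apply continuous_comp; [now apply (lipschitz_continuous K)|].
      apply continuous_Rinv; generalize (Hpos z); lra.
    - apply continuous_comp; [now apply (lipschitz_continuous K)|].
      apply continuous_Rinv; generalize (Hpos x); lra. }
  assert (HTx0 : T x0 = 0) by (unfold T; rewrite RInt_point; reflexivity).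
  (* Comparison of [1 / f] with [1 / (K (b - x))] and [1 / (K (x - a))] *)
  assert (Hfb : forall x, a < x < b -> f x <= K * (b - x)).
  { intros x Hx; generalize (Hf x b); rewrite Hb.
    rewrite Rabs_pos_eq by (generalize (Hpos x); lra).
    rewrite Rabs_left by lra; lra. }
  assert (Hfa : forall x, a < x < b -> f x <= K * (x - a)).
  { intros x Hx; generalize (Hf x a); rewrite Ha.
    rewrite Rabs_pos_eq by (generalize (Hpos x); lra).
    rewrite Rabs_pos_eq by lra; lra. }
  assert (Hhigh : forall t, 0 <= t -> exists x, x0 <= x < b /\ t <= T x).
  { intros t Ht; exists (b - (b - x0) * exp (- (K * t))).
    set (x := b - _).
    assert (He : 0 < exp (- (K * t)) <= 1).
    { split; [apply exp_pos|]; rewrite <- exp_0.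
      destruct (Req_dec t 0) as [->|Ht0]; [right; f_equal; ring|].
      left; apply exp_increasing; nra. }
    assert (Hx : x0 <= x < b) by (unfold x; split; nra).
    split; [exact Hx|].
    destruct (increment_between (fun x => T x + ln (b - x) / K)
      (fun x => / f x - / (K * (b - x))) a b x0 x) as (c & _ & Hc & E); [|lra|lra|].
    { intros z Hz; apply (is_derive_plus T); [now apply HT|].
      auto_derive; [lra | field; lra]. }
    assert (0 <= / f c - / (K * (b - c))).
    { apply Rge_le, Rge_minus, Rle_ge, Rinv_le_contravar;
        [now apply Hpos | now apply Hfb]. }
    assert (0 <= (/ f c - / (K * (b - c))) * (x - x0))
      by (apply Rmult_le_pos; lra).
    rewrite HTx0 in E.
    replace (b - x) with ((b - x0) * exp (- (K * t))) in E by (unfold x; ring).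
    rewrite ln_mult, ln_exp in E by (try apply exp_pos; lra).
    replace ((ln (b - x0) + - (K * t)) / K) with (ln (b - x0) / K - t) in E
      by (field; lra).
    lra. }
  assert (Hlow : forall t, t <= 0 -> exists x, a < x <= x0 /\ T x <= t).
  { intros t Ht; exists (a + (x0 - a) * exp (K * t)).
    set (x := a + _).
    assert (He : 0 < exp (K * t) <= 1).
    { split; [apply exp_pos|]; rewrite <- exp_0.
      destruct (Req_dec t 0) as [->|Ht0]; [right; f_equal; ring|].
      left; apply exp_increasing; nra. }
    assert (Hx : a < x <= x0) by (unfold x; split; nra).
    split; [exact Hx|].
    destruct (increment_between (fun x => T x - ln (x - a) / K)
      (fun x => / f x - / (K * (x - a))) a b x x0) as (c & _ & Hc & E); [|lra|lra|].
    { intros z Hz; apply (is_derive_minus T); [now apply HT|].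
      auto_derive; [lra | field; lra]. }
    assert (0 <= / f c - / (K * (c - a))).
    { apply Rge_le, Rge_minus, Rle_ge, Rinv_le_contravar;
        [now apply Hpos | now apply Hfa]. }
    assert (0 <= (/ f c - / (K * (c - a))) * (x0 - x))
      by (apply Rmult_le_pos; lra).
    rewrite HTx0 in E.
    replace (x - a) with ((x0 - a) * exp (K * t)) in E by (unfold x; ring).
    rewrite ln_mult, ln_exp in E by (try apply exp_pos; lra).
    replace ((ln (x0 - a) + K * t) / K) with (ln (x0 - a) / K + t) in E
      by (field; lra).
    lra. }
  assert (Hmono : forall x y, a < x < b -> a < y < b -> x < y -> T x < T y).
  { intros x y Hx Hy Hxy.
    destruct (increment_between T (fun x => / f x) a b x y HT Hx Hy)
      as (c & _ & Hc & E).
    assert (0 < / f c) by (apply Rinv_0_lt_compat, Hpos, Hc).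
    nra. }
  assert (Hsurj : forall t, exists x, a < x < b /\ T x = t).
  { intros t.
    destruct (Hhigh (Rabs t + 1)) as (x2 & Hx2 & HT2);
      [generalize (Rabs_pos t); lra|].
    destruct (Hlow (- Rabs t - 1)) as (x1 & Hx1 & HT1);
      [generalize (Rabs_pos t); lra|].
    assert (Ht : - Rabs t <= t <= Rabs t) by (apply Rabs_le_between; lra).
    assert (x1 < x2).
    { destruct (Req_dec x1 x2) as [->|]; lra. }
    destruct (IVT_interv (fun x => T x - t) x1 x2) as (x & Hx & E); try lra.
    - intros z Hz; apply continuity_pt_minus; [|apply continuity_pt_const; now intro].
      apply derivable_continuous_pt; exists (/ f z); apply is_derive_Reals, HT; lra.
    - exists x; lra. }
  destruct (functional_choice _ Hsurj) as [g Hg].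
  assert (Hgmono : forall s x, a < x < b -> T x < s -> x < g s).
  { intros s x Hx Hs; destruct (Hg s) as [Hgs E].
    destruct (Rtotal_order x (g s)) as [H|[H|H]]; [exact H| |].
    - rewrite H in Hs; lra.
    - generalize (Hmono _ _ Hgs Hx H); lra. }
  assert (Hgmono' : forall s x, a < x < b -> s < T x -> g s < x).
  { intros s x Hx Hs; destruct (Hg s) as [Hgs E].
    destruct (Rtotal_order x (g s)) as [H|[H|H]]; [| |exact H].
    - generalize (Hmono _ _ Hx Hgs H); lra.
    - rewrite H in Hs; lra. }
  exists g; split; [apply Hg|split; [|split]].
  - intros t; apply is_derive_of_quadratic_remainder with (K * (K * (b - a))).
    { apply Rmult_le_pos; [lra|apply Rmult_le_pos; lra]. }
    intros s.
    destruct (Hg t) as [Hgt Et], (Hg s) as [Hgs Es].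
    destruct (increment_between T (fun x => / f x) a b (g t) (g s) HT Hgt Hgs)
      as (c & Hcm & Hc & E).
    rewrite Et, Es in E.
    assert (Hfc := Hpos c Hc).
    assert (E' : g s - g t = f c * (s - t)) by (rewrite E; field; lra).
    rewrite E'.
    replace (f c * (s - t) - f (g t) * (s - t)) with ((f c - f (g t)) * (s - t)) by ring.
    rewrite Rabs_mult.
    replace ((s - t) ^ 2) with (Rabs (s - t) * Rabs (s - t))
      by (rewrite <- (pow2_abs (s - t)); ring).
    rewrite <- Rmult_assoc.
    apply Rmult_le_compat_r; [apply Rabs_pos|].
    apply Rle_trans with (1 := Hf c (g t)).
    rewrite Rmult_assoc.
    apply Rmult_le_compat_l; [lra|].
    apply Rle_trans with (Rabs (g s - g t)).
    { generalize Hcm; unfold Rmin, Rmax; destruct Rle_dec;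
        unfold Rabs; repeat destruct Rcase_abs; lra. }
    rewrite E', Rabs_mult; apply Rmult_le_compat_r; [apply Rabs_pos|].
    rewrite Rabs_pos_eq by lra.
    apply Rle_trans with (1 := Hfb c Hc); apply Rmult_le_compat_l; lra.
  - apply filterlim_locally; intros e.
    assert (He := cond_pos e).
    set (x := a + Rmin e ((b - a)) / 2).
    assert (Hm : 0 < Rmin e (b - a)) by (apply Rmin_glb_lt; lra).
    assert (H1 := Rmin_l e (b - a)). assert (H2 := Rmin_r e (b - a)).
    exists (T x); intros t Ht.
    assert (g t < x) by (apply Hgmono'; [unfold x; lra | exact Ht]).
    destruct (Hg t) as [Hgt _].
    apply Rabs_lt_between; unfold minus, plus, opp; simpl; unfold x in *; lra.
  - apply filterlim_locally; intros e.
    assert (He := cond_pos e).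
    set (x := b - Rmin e ((b - a)) / 2).
    assert (Hm : 0 < Rmin e (b - a)) by (apply Rmin_glb_lt; lra).
    assert (H1 := Rmin_l e (b - a)). assert (H2 := Rmin_r e (b - a)).
    exists (T x); intros t Ht.
    assert (x < g t) by (apply Hgmono; [unfold x; lra | exact Ht]).
    destruct (Hg t) as [Hgt _].
    apply Rabs_lt_between; unfold minus, plus, opp; simpl; unfold x in *; lra.
Qed.

Lemma scalar_orbit_decreasing (f : R -> R) (a b K : R) :
  a < b -> 0 < K -> lipschitz K f -> f a = 0 -> f b = 0 ->
  (forall x, a < x < b -> f x < 0) ->
  exists g : R -> R,
    (forall t, a < g t < b) /\
    (forall t, is_derive g t (f (g t))) /\
    filterlim g (Rbar_locally m_infty) (locally b) /\
    filterlim g (Rbar_locally p_infty) (locally a).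
Proof.
  intros Hab HK Hf Ha Hb Hneg.
  destruct (scalar_orbit (fun x => - f (- x)) (- b) (- a) K)
    as (g & Hg & Hg' & Hm & Hp); try rewrite !Ropp_involutive; try lra.
  - intros x y; generalize (Hf (- y) (- x)).
    replace (- y - - x) with (x - y) by ring.
    now replace (- f (- x) - - f (- y)) with (f (- y) - f (- x)) by ring.
  - intros x Hx; generalize (Hneg (- x)); lra.
  - exists (fun t => - g t); split; [intros t; generalize (Hg t); lra|split; [|split]].
    + intros t; rewrite <- (Ropp_involutive (f _)); apply (is_derive_opp g), Hg'.
    + rewrite <- (Ropp_involutive b).
      apply (filterlim_comp _ _ _ g Ropp _ (locally (- b))); [exact Hm|].
      apply (filterlim_opp (- b)).
    + rewrite <- (Ropp_involutive a).
      apply (filterlim_comp _ _ _ g Ropp _ (locally (- a))); [exact Hp|].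
      apply (filterlim_opp (- a)).
Qed.

(** Bounded Lipschitz functions form an algebra, which contains the
    trigonometric polynomials. *)
Definition bounded_lipschitz (f : R -> R) : Prop :=
  exists K, 0 < K /\ (forall x, Rabs (f x) <= K) /\ lipschitz K f.

Lemma bounded_lipschitz_const (c : R) : bounded_lipschitz (fun _ => c).
Proof.
  exists (Rabs c + 1); assert (H := Rabs_pos c); repeat split; [lra|intros; lra|].
  intros x y; rewrite Rminus_diag, Rabs_R0.
  apply Rmult_le_pos; [lra|apply Rabs_pos].
Qed.

Lemma bounded_lipschitz_plus (f g : R -> R) :
  bounded_lipschitz f -> bounded_lipschitz g ->
  bounded_lipschitz (fun x => f x + g x).
Proof.
  intros (K & HK & Hf & Hf') (L & HL & Hg & Hg').
  exists (K + L); repeat split; [lra| |].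
  - intros x; eapply Rle_trans; [apply Rabs_triang|].
    generalize (Hf x) (Hg x); lra.
  - intros x y; replace (_ - _) with ((f x - f y) + (g x - g y)) by ring.
    eapply Rle_trans; [apply Rabs_triang|].
    generalize (Hf' x y) (Hg' x y); lra.
Qed.

Lemma bounded_lipschitz_mult (f g : R -> R) :
  bounded_lipschitz f -> bounded_lipschitz g ->
  bounded_lipschitz (fun x => f x * g x).
Proof.
  intros (K & HK & Hf & Hf') (L & HL & Hg & Hg').
  exists (2 * K * L); assert (0 < K * L) by nra; repeat split; [lra| |].
  - intros x; rewrite Rabs_mult.
    generalize (Hf x) (Hg x) (Rabs_pos (f x)) (Rabs_pos (g x)); nra.
  - intros x y; replace (_ - _) with (f x * (g x - g y) + (f x - f y) * g y) by ring.
    eapply Rle_trans; [apply Rabs_triang|]; rewrite !Rabs_mult.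
    replace (2 * K * L * Rabs (x - y))
      with (K * (L * Rabs (x - y)) + (K * Rabs (x - y)) * L) by ring.
    apply Rplus_le_compat; apply Rmult_le_compat; auto using Rabs_pos.
Qed.

Lemma bounded_lipschitz_of_derivative (f df : R -> R) :
  (forall x, Rabs (f x) <= 1) -> (forall x, is_derive f x (df x)) ->
  (forall x, Rabs (df x) <= 1) -> bounded_lipschitz f.
Proof.
  intros Hf Hd Hd'; exists 1; repeat split; [lra|exact Hf|].
  intros x y.
  destruct (MVT_gen f y x df) as (c & _ & ->).
  - intros; apply Hd.
  - intros z _; apply derivable_continuous_pt; exists (df z).
    apply is_derive_Reals, Hd.
  - rewrite Rabs_mult; apply Rmult_le_compat_r; [apply Rabs_pos|apply Hd'].
Qed.

Lemma bounded_lipschitz_sin : bounded_lipschitz sin.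
Proof.
  apply (bounded_lipschitz_of_derivative sin cos).
  - intros x; apply Rabs_le; generalize (SIN_bound x); lra.
  - intros x; auto_derive; [auto|ring].
  - intros x; apply Rabs_le; generalize (COS_bound x); lra.
Qed.

Lemma bounded_lipschitz_cos : bounded_lipschitz cos.
Proof.
  apply (bounded_lipschitz_of_derivative cos (fun x => - sin x)).
  - intros x; apply Rabs_le; generalize (COS_bound x); lra.
  - intros x; auto_derive; [auto|ring].
  - intros x; apply Rabs_le; generalize (SIN_bound x); lra.
Qed.

Lemma bounded_lipschitz_ext (f g : R -> R) :
  (forall x, f x = g x) -> bounded_lipschitz f -> bounded_lipschitz g.
Proof.
  intros H (K & HK & Hf & Hf'); exists K; repeat split; [exact HK| |].
  - intros; rewrite <- H; apply Hf.
  - intros x y; rewrite <- !H; apply Hf'.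
Qed.

(** * Topological invariants of a phase portrait *)

Definition equilibrium (lam : R) (Q : R * R -> R * R) (m : R * R * R) : Prop :=
  poincare_disk m /\ trajectory lam Q (fun _ => m).

Definition connection (lam : R) (Q : R * R -> R * R) (a b : R * R * R) : Prop :=
  a <> b /\ equilibrium lam Q a /\ equilibrium lam Q b /\
  exists c : R -> R * R * R, trajectory lam Q c /\
    filterlim c (Rbar_locally m_infty) (locally a) /\
    filterlim c (Rbar_locally p_infty) (locally b).

Definition source (lam : R) (Q : R * R -> R * R) (m : R * R * R) : Prop :=
  equilibrium lam Q m /\ forall a, ~ connection lam Q a m.

(** A saddle at infinity entered only by two arcs of the circle at infinity is
    branching; this separates portraits with equal numbers of equilibria and of
    sources. *)
Definition branching (lam : R) (Q : R * R -> R * R) (m : R * R * R) : Prop :=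
  (forall a, connection lam Q a m -> ~ source lam Q a) /\
  exists a b, a <> b /\ connection lam Q a m /\ connection lam Q b m.

(** One direction of a topological equivalence, with the inverse map given, so
    that the two directions are instances of the same notion. *)
Definition conjugation (lam : R) (Q : R * R -> R * R)
    (lam' : R) (Q' : R * R -> R * R) (h h' : R * R * R -> R * R * R) : Prop :=
  (forall m, poincare_disk m -> poincare_disk (h m) /\ h' (h m) = m) /\
  continuous_on poincare_disk h /\
  (forall c, (forall t, poincare_disk (c t)) -> trajectory lam Q c ->
     trajectory lam' Q' (fun t => h (c t))).

Lemma trajectory_in_disk (lam : R) (Q : R * R -> R * R) (c : R -> R * R * R) (t : R) :
  trajectory lam Q c -> poincare_disk (c t).
Proof. intros (g & tau & Hg & _ & _ & E); rewrite E; apply Hg. Qed.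

Lemma topologically_equivalent_conjugation (lam lam' : R) (Q Q' : R * R -> R * R) :
  topologically_equivalent lam Q lam' Q' ->
  exists h h', conjugation lam Q lam' Q' h h' /\ conjugation lam' Q' lam Q h' h.
Proof.
  intros (h & (Hh & Hc & h' & Hh' & Hc' & Hinv & Hinv') & Htraj).
  exists h, h'; split; split; [now auto|split; [exact Hc|]|now auto|split; [exact Hc'|]].
  - intros c Hd; apply (Htraj c Hd).
  - intros c Hd H; apply Htraj; [auto|].
    destruct H as (g & tau & Hg & Hm & Hs & E).
    exists g, tau; repeat split; auto; try apply Hg; intros t.
    rewrite <- E; auto.
Qed.

Lemma conjugation_equilibrium (lam lam' : R) (Q Q' : R * R -> R * R)
    (h h' : R * R * R -> R * R * R) (m : R * R * R) :
  conjugation lam Q lam' Q' h h' -> equilibrium lam Q m -> equilibrium lam' Q' (h m).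
Proof.
  intros (Hh & _ & Ht) [Hm Hc]; split; [now apply Hh|].
  apply (Ht (fun _ => m)); auto.
Qed.

Lemma conjugation_connection (lam lam' : R) (Q Q' : R * R -> R * R)
    (h h' : R * R * R -> R * R * R) (a b : R * R * R) :
  conjugation lam Q lam' Q' h h' -> connection lam Q a b ->
  connection lam' Q' (h a) (h b).
Proof.
  intros H (Hab & Ha & Hb & c & Hc & Hca & Hcb).
  assert (Hlim : forall F m, Filter F -> poincare_disk m -> filterlim c F (locally m) ->
    filterlim (fun t => h (c t)) F (locally (h m))).
  { intros F m HF Hm Hl; destruct H as (_ & Hcont & _).
    apply (filterlim_comp _ _ _ c h _ (within poincare_disk (locally m)));
      [|now apply Hcont].
    intros P HP; apply Hl in HP; revert HP; unfold filtermap; apply filter_imp.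
    intros t HP; apply HP; now apply (trajectory_in_disk lam Q). }
  split; [|split; [|split]].
  - destruct H as (Hh & _); intros E; apply Hab.
    rewrite <- (proj2 (Hh a (proj1 Ha))), <- (proj2 (Hh b (proj1 Hb))); congruence.
  - eapply conjugation_equilibrium; eassumption.
  - eapply conjugation_equilibrium; eassumption.
  - exists (fun t => h (c t)); split; [|split].
    + apply H; [intros t; now apply (trajectory_in_disk lam Q)|exact Hc].
    + apply Hlim; [typeclasses eauto|apply Ha|exact Hca].
    + apply Hlim; [typeclasses eauto|apply Hb|exact Hcb].
Qed.

Lemma conjugation_source (lam lam' : R) (Q Q' : R * R -> R * R)
    (h h' : R * R * R -> R * R * R) (m : R * R * R) :
  conjugation lam Q lam' Q' h h' -> conjugation lam' Q' lam Q h' h ->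
  source lam Q m -> source lam' Q' (h m).
Proof.
  intros H H' [Hm Hs]; split; [eapply conjugation_equilibrium; eassumption|].
  intros a Ha; apply (Hs (h' a)).
  rewrite <- (proj2 (proj1 H m (proj1 Hm))).
  eapply conjugation_connection; eassumption.
Qed.

Lemma conjugation_branching (lam lam' : R) (Q Q' : R * R -> R * R)
    (h h' : R * R * R -> R * R * R) (m : R * R * R) :
  conjugation lam Q lam' Q' h h' -> conjugation lam' Q' lam Q h' h ->
  branching lam Q m -> branching lam' Q' (h m).
Proof.
  intros H H' (Hs & a & b & Hab & Ha & Hb); split.
  - intros x Hx Hsx; apply (Hs (h' x)); [|eapply conjugation_source; eassumption].
    rewrite <- (proj2 (proj1 H m (proj1 (proj1 (proj2 (proj2 Ha)))))).
    eapply conjugation_connection; eassumption.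
  - exists (h a), (h b); split; [|split; eapply conjugation_connection; eassumption].
    intros E; apply Hab.
    rewrite <- (proj2 (proj1 H a (proj1 (proj1 (proj2 Ha))))).
    rewrite <- (proj2 (proj1 H b (proj1 (proj1 (proj2 Hb))))).
    congruence.
Qed.

Definition has_cardinal (P : R * R * R -> Prop) (n : nat) : Prop :=
  exists l, NoDup l /\ length l = n /\ forall m, P m <-> In m l.

Lemma has_cardinal_le (P P' : R * R * R -> Prop) (h h' : R * R * R -> R * R * R)
    (n n' : nat) :
  (forall m, P m -> P' (h m) /\ h' (h m) = m) ->
  has_cardinal P n -> has_cardinal P' n' -> (n <= n')%nat.
Proof.
  intros Hh (l & Hl & <- & HP) (l' & Hl' & <- & HP').
  rewrite <- (length_map h l); apply NoDup_incl_length.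
  - apply NoDup_map_NoDup_ForallPairs; [|exact Hl].
    intros x y Hx Hy E; apply HP in Hx, Hy.
    rewrite <- (proj2 (Hh x Hx)), <- (proj2 (Hh y Hy)); congruence.
  - intros y Hy; apply in_map_iff in Hy as (x & <- & Hx).
    apply HP', Hh, HP, Hx.
Qed.

Lemma cardinal_equilibria_invariant (lam lam' : R) (Q Q' : R * R -> R * R) (n n' : nat) :
  topologically_equivalent lam Q lam' Q' ->
  has_cardinal (equilibrium lam Q) n -> has_cardinal (equilibrium lam' Q') n' ->
  n = n'.
Proof.
  intros He H H'.
  destruct (topologically_equivalent_conjugation _ _ _ _ He) as (h & h' & Hc & Hc').
  apply PeanoNat.Nat.le_antisymm.
  - apply (has_cardinal_le _ _ h h' _ _) with (2 := H) (3 := H').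
    intros m Hm; split; [eapply conjugation_equilibrium; eassumption|].
    apply Hc, Hm.
  - apply (has_cardinal_le _ _ h' h _ _) with (2 := H') (3 := H).
    intros m Hm; split; [eapply conjugation_equilibrium; eassumption|].
    apply Hc', Hm.
Qed.

Lemma cardinal_sources_invariant (lam lam' : R) (Q Q' : R * R -> R * R) (n n' : nat) :
  topologically_equivalent lam Q lam' Q' ->
  has_cardinal (source lam Q) n -> has_cardinal (source lam' Q') n' ->
  n = n'.
Proof.
  intros He H H'.
  destruct (topologically_equivalent_conjugation _ _ _ _ He) as (h & h' & Hc & Hc').
  apply PeanoNat.Nat.le_antisymm.
  - apply (has_cardinal_le _ _ h h' _ _) with (2 := H) (3 := H').
    intros m Hm; split; [apply (conjugation_source _ _ _ _ _ _ _ Hc Hc' Hm)|].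
    apply Hc, Hm.
  - apply (has_cardinal_le _ _ h' h _ _) with (2 := H') (3 := H).
    intros m Hm; split; [apply (conjugation_source _ _ _ _ _ _ _ Hc' Hc Hm)|].
    apply Hc', Hm.
Qed.

(** Separates a portrait with infinitely many equilibria from all others. *)
Lemma finite_equilibria_invariant (lam lam' : R) (Q Q' : R * R -> R * R) (n : nat) :
  topologically_equivalent lam Q lam' Q' ->
  has_cardinal (equilibrium lam Q) n -> exists n', has_cardinal (equilibrium lam' Q') n'.
Proof.
  intros He (l & Hl & _ & HP).
  destruct (topologically_equivalent_conjugation _ _ _ _ He) as (h & h' & Hc & Hc').
  exists (length (map h l)), (map h l); split; [|split; [reflexivity|]].
  - apply NoDup_map_NoDup_ForallPairs; [|exact Hl].
    intros x y Hx Hy E; apply HP in Hx, Hy.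
    rewrite <- (proj2 (proj1 Hc x (proj1 Hx))), <- (proj2 (proj1 Hc y (proj1 Hy)));
      congruence.
  - intros m; rewrite in_map_iff; split.
    + intros Hm; exists (h' m); split; [apply Hc', Hm|].
      apply HP; eapply conjugation_equilibrium; eassumption.
    + intros (x & <- & Hx); eapply conjugation_equilibrium; [eassumption|].
      now apply HP.
Qed.

Lemma topologically_equivalent_sym (lam lam' : R) (Q Q' : R * R -> R * R) :
  topologically_equivalent lam Q lam' Q' -> topologically_equivalent lam' Q' lam Q.
Proof.
  intros (h & (Hh & Hc & h' & Hh' & Hc' & Hinv & Hinv') & Htraj).
  exists h'; split.
  { split; [exact Hh'|split; [exact Hc'|]]; exists h; auto. }
  intros c Hd; rewrite (Htraj (fun t => h' (c t))) by auto.
  split; intros (g & tau & Hg & Hm & Hs & E); exists g, tau;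
    repeat split; auto; try apply Hg; intros t.
  - rewrite Hinv'; auto.
  - rewrite <- E, Hinv'; auto.
Qed.

(** * Solutions *)

Lemma solution_trajectory (lam : R) (Q : R * R -> R * R) (g : R -> R * R * R) :
  solution lam Q g -> trajectory lam Q g.
Proof.
  intros H; exists g, (fun t => t); repeat split; auto; try apply H.
  intros r; now exists r.
Qed.

Lemma connection_solution (lam : R) (Q : R * R -> R * R) (a b : R * R * R) :
  connection lam Q a b ->
  exists g, solution lam Q g /\
    filterlim g (Rbar_locally m_infty) (locally a) /\
    filterlim g (Rbar_locally p_infty) (locally b).
Proof.
  intros (_ & _ & _ & c & (g & tau & Hg & Hm & Hs & E) & Ha & Hb).
  exists g; split; [exact Hg|split].
  - intros P HP; apply Ha in HP as [T HT]; exists (tau T); intros r Hr.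
    destruct (Hs r) as [t Ht].
    replace (g r) with (c t) by (rewrite E, Ht; reflexivity); apply HT.
    destruct (Rlt_or_le t T) as [|Hle]; [assumption|].
    destruct (Req_dec t T) as [->|]; [lra|]. generalize (Hm T t); lra.
  - intros P HP; apply Hb in HP as [T HT]; exists (tau T); intros r Hr.
    destruct (Hs r) as [t Ht].
    replace (g r) with (c t) by (rewrite E, Ht; reflexivity); apply HT.
    destruct (Rlt_or_le T t) as [|Hle]; [assumption|].
    destruct (Req_dec t T) as [->|]; [lra|]. generalize (Hm t T); lra.
Qed.

Lemma equilibrium_iff (lam : R) (Q : R * R -> R * R) (m : R * R * R) :
  equilibrium lam Q m <->
  poincare_disk m /\ compactified_field lam Q m = (0, 0, 0).
Proof.
  split; intros [Hd H]; split; try exact Hd.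
  - destruct H as (g & tau & Hg & _ & Hs & E).
    assert (Hc : forall r, g r = m)
      by (intros r; destruct (Hs r) as [t <-]; now rewrite <- E).
    destruct (Hg 0) as (_ & H1 & H2 & H3).
    rewrite Hc in H1, H2, H3.
    assert (H0 : forall (f : R -> R) (k l : R), (forall t, f t = k) ->
      is_derive f 0 l -> l = 0).
    { intros f k l Hf Hl; rewrite <- (is_derive_unique _ _ _ Hl).
      rewrite (Derive_ext _ (fun _ => k)) by exact Hf; apply Derive_const. }
    apply (H0 _ (fst (fst m))) in H1; [|intros; now rewrite Hc].
    apply (H0 _ (snd (fst m))) in H2; [|intros; now rewrite Hc].
    apply (H0 _ (snd m)) in H3; [|intros; now rewrite Hc].
    destruct (compactified_field lam Q m) as [[z1 z2] z3]; simpl in *; congruence.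
  - apply solution_trajectory; intros t; cbv zeta; rewrite H; simpl.
    split; [exact Hd|]; split; [|split]; apply (is_derive_const (V := R_NormedModule)).
Qed.

(** * Equilibria and the two kinds of invariant curves *)

Definition zero_direction (Q : R * R -> R * R) (d : R * R) : Prop :=
  fst d ^ 2 + snd d ^ 2 = 1 /\ calG Q (fst d) (snd d) = 0.

Definition radial (Q : R * R -> R * R) (d : R * R) : R := calF Q (fst d) (snd d).

(** The half meridian over the ray in direction [d], parametrised by the angle
    from the pole: [phi = 0] is the origin of the plane, [phi = PI / 2] lies at
    infinity. *)
Definition ray (d : R * R) (phi : R) : R * R * R :=
  (fst d * sin phi, snd d * sin phi, cos phi).

Definition origin : R * R * R := (0, 0, 1).

Definition at_infinity (d : R * R) : R * R * R := (fst d, snd d, 0).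

(** On the ray in direction [d], the planar system is
    [r' = lam * r + radial Q d * r ^ 2]; this is the image of its zero
    [r = - lam / radial Q d]. *)
Definition finite_equilibrium (lam : R) (Q : R * R -> R * R) (d : R * R) : R * R * R :=
  ray d (atan (- lam / radial Q d)).

Lemma ray_origin (d : R * R) : ray d 0 = origin.
Proof. unfold ray, origin; rewrite sin_0, cos_0, !Rmult_0_r; reflexivity. Qed.

Lemma ray_at_infinity (d : R * R) : ray d (PI / 2) = at_infinity d.
Proof.
  unfold ray, at_infinity; rewrite sin_PI2, cos_PI2, !Rmult_1_r; reflexivity.
Qed.

Lemma homogeneous_scaling (Q : R * R -> R * R) (s x y : R) :
  homogeneous_quadratic Q ->
  Q (s * x, s * y) = (s ^ 2 * fst (Q (x, y)), s ^ 2 * snd (Q (x, y))).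
Proof.
  intros (a & b & c & a' & b' & c' & HQ); rewrite !HQ; cbn [fst snd].
  f_equal; ring.
Qed.

Lemma zero_direction_field (Q : R * R -> R * R) (d : R * R) :
  zero_direction Q d -> Q d = (radial Q d * fst d, radial Q d * snd d).
Proof.
  destruct d as [p q]; unfold zero_direction, radial, calG, calF; cbn [fst snd].
  destruct (Q (p, q)) as [U V]; cbn [fst snd]; intros [H1 H2].
  f_equal.
  - transitivity ((p ^ 2 + q ^ 2) * U + q * (p * V - q * U)); [|ring].
    rewrite H1, H2; ring.
  - transitivity ((p ^ 2 + q ^ 2) * V - p * (p * V - q * U)); [|ring].
    rewrite H1, H2; ring.
Qed.

Lemma compactified_field_ray (lam : R) (Q : R * R -> R * R) (d : R * R) (phi : R) :
  homogeneous_quadratic Q -> zero_direction Q d ->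
  let f := cos phi * sin phi * (lam * cos phi + radial Q d * sin phi) in
  compactified_field lam Q (ray d phi) =
  (fst d * cos phi * f, snd d * cos phi * f, - sin phi * f).
Proof.
  intros HQ Hd; cbv zeta.
  assert (E := zero_direction_field Q d Hd).
  unfold compactified_field, ray.
  rewrite (Rmult_comm (fst d)), (Rmult_comm (snd d)), homogeneous_scaling by exact HQ.
  destruct d as [p q]; cbn [fst snd] in *; rewrite E; cbn [fst snd].
  destruct Hd as [Hd _]; cbn [fst snd] in Hd.
  assert (Hs := sin2_cos2 phi); unfold Rsqr in Hs.
  set (s := sin phi) in *. set (c := cos phi) in *.
  set (F := radial Q (p, q)).
  assert (Hq : q * q = 1 - p * p) by (simpl in Hd; lra).
  assert (HA : s * p * (lam * c * (s * p) + s ^ 2 * (F * p))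
    + s * q * (lam * c * (s * q) + s ^ 2 * (F * q))
    = s ^ 2 * (lam * c + F * s)).
  { transitivity (s ^ 2 * (lam * c + F * s) * (p * p + q * q)); [ring|].
    rewrite Hq; ring. }
  rewrite HA.
  assert (Hc : c * c = 1 - s * s) by lra.
  f_equal; [f_equal|].
  - transitivity (p * (c * c) * s * (lam * c + F * s)); [rewrite Hc|]; ring.
  - transitivity (q * (c * c) * s * (lam * c + F * s)); [rewrite Hc|]; ring.
  - ring.
Qed.

Lemma ray_in_disk (Q : R * R -> R * R) (d : R * R) (phi : R) :
  zero_direction Q d -> 0 <= phi <= PI / 2 -> poincare_disk (ray d phi).
Proof.
  intros [Hd _] Hphi; split.
  - transitivity ((fst d ^ 2 + snd d ^ 2) * Rsqr (sin phi) + Rsqr (cos phi));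
      [unfold Rsqr; ring|].
    rewrite Hd, Rmult_1_l; apply sin2_cos2.
  - apply cos_ge_0; generalize PI_RGT_0; lra.
Qed.

Lemma continuous_pair (f g : R -> R) (x : R) :
  continuous f x -> continuous g x -> continuous (fun y => (f y, g y)) x.
Proof.
  intros Hf Hg; apply (continuous_comp_2 f g (fun a b => (a, b))); auto.
  apply (continuous_ext (fun z : R * R => z)); [now intros []|apply continuous_id].
Qed.

Lemma continuous_triple (f g h : R -> R) (x : R) :
  continuous f x -> continuous g x -> continuous h x ->
  continuous (fun y => (f y, g y, h y)) x.
Proof.
  intros Hf Hg Hh.
  apply (continuous_comp_2 (fun y => (f y, g y)) h (fun a b => (a, b))); auto.
  - now apply continuous_pair.
  - apply (continuous_ext (fun z : R * R * R => z)); [now intros []|apply continuous_id].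
Qed.

Lemma continuous_ray (d : R * R) (phi : R) : continuous (ray d) phi.
Proof.
  unfold ray; apply continuous_triple; apply (ex_derive_continuous (V := R_NormedModule)); auto_derive; auto.
Qed.

(** On the ray in a zero direction the extended field reduces to a scalar
    equation for [phi]: a trajectory runs along it from the origin to the next
    equilibrium. *)
Lemma ray_connection_to (lam : R) (Q : R * R -> R * R) (d : R * R) (phi1 : R) :
  homogeneous_quadratic Q -> zero_direction Q d -> 0 < phi1 <= PI / 2 ->
  let f phi := cos phi * sin phi * (lam * cos phi + radial Q d * sin phi) in
  f phi1 = 0 -> (forall phi, 0 < phi < phi1 -> 0 < f phi) ->
  connection lam Q origin (ray d phi1).
Proof.
  intros HQ Hd Hphi1 f H1 Hpos.
  assert (HPI := PI_RGT_0).
  assert (Hf : bounded_lipschitz f).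
  { unfold f.
    apply (bounded_lipschitz_mult (fun phi => cos phi * sin phi));
      [apply bounded_lipschitz_mult; auto using bounded_lipschitz_cos, bounded_lipschitz_sin|].
    apply (bounded_lipschitz_plus (fun phi => lam * cos phi));
      apply (bounded_lipschitz_mult (fun _ => _));
      auto using bounded_lipschitz_cos, bounded_lipschitz_sin, bounded_lipschitz_const. }
  destruct Hf as (K & HK & _ & Hf).
  assert (H0 : f 0 = 0) by (unfold f; rewrite sin_0; ring).
  destruct (scalar_orbit f 0 phi1 K) as (g & Hg & Hg' & Hm & Hp); auto; try lra.
  assert (Hs : solution lam Q (fun t => ray d (g t))).
  { intros t; split; [apply (ray_in_disk Q); auto; generalize (Hg t); lra|].
    rewrite (compactified_field_ray lam Q d (g t) HQ Hd); cbv zeta; fold (f (g t)).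
    unfold ray; cbn [fst snd].
    split; [|split]; (auto_derive; [exists (f (g t)); exact (Hg' t)|]);
      change (fun x : R => g x) with g; rewrite (is_derive_unique _ _ _ (Hg' t)); ring. }
  split; [|split; [|split]].
  - intros E; apply (f_equal snd) in E; simpl in E.
    assert (cos phi1 < cos 0) by (apply cos_decreasing_1; lra).
    rewrite cos_0 in *; lra.
  - apply equilibrium_iff; rewrite <- (ray_origin d).
    split; [apply (ray_in_disk Q); auto; lra|].
    rewrite (compactified_field_ray lam Q d 0 HQ Hd); cbv zeta; fold (f 0); rewrite H0.
    f_equal; [f_equal|]; ring.
  - apply equilibrium_iff; split; [apply (ray_in_disk Q); auto; lra|].
    rewrite (compactified_field_ray lam Q d phi1 HQ Hd); cbv zeta; fold (f phi1);
      rewrite H1; f_equal; [f_equal|]; ring.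
  - exists (fun t => ray d (g t)); split; [now apply solution_trajectory|].
    rewrite <- (ray_origin d); split.
    + apply (filterlim_comp _ _ _ g (ray d) _ (locally 0)); [exact Hm|].
      apply (continuous_ray d).
    + apply (filterlim_comp _ _ _ g (ray d) _ (locally phi1)); [exact Hp|].
      apply (continuous_ray d).
Qed.

Lemma ray_connection_infinity (lam : R) (Q : R * R -> R * R) (d : R * R) :
  homogeneous_quadratic Q -> 0 < lam -> zero_direction Q d -> 0 <= radial Q d ->
  connection lam Q origin (at_infinity d).
Proof.
  intros HQ Hlam Hd HF; assert (HPI := PI_RGT_0); rewrite <- ray_at_infinity.
  apply ray_connection_to; auto; [lra|rewrite cos_PI2; ring|].
  intros phi Hphi.
  assert (0 < sin phi) by (apply sin_gt_0; lra).
  assert (0 < cos phi) by (apply cos_gt_0; lra).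
  apply Rmult_lt_0_compat; [now apply Rmult_lt_0_compat|]; nra.
Qed.

Lemma finite_angle (lam F : R) :
  0 < lam -> F < 0 ->
  let phi := atan (- lam / F) in
  0 < phi < PI / 2 /\ lam * cos phi + F * sin phi = 0.
Proof.
  intros Hlam HF phi.
  assert (Hr : 0 < - lam / F).
  { replace (- lam / F) with (lam * / - F) by (field; lra).
    apply Rmult_lt_0_compat; [lra|apply Rinv_0_lt_compat; lra]. }
  assert (Hb := atan_bound (- lam / F)); fold phi in Hb.
  assert (0 < phi) by (unfold phi; rewrite <- atan_0; now apply atan_increasing).
  split; [lra|].
  assert (Hc : 0 < cos phi) by (apply cos_gt_0; lra).
  assert (Ht : tan phi = - lam / F) by apply tan_atan.
  unfold tan in Ht.
  replace (sin phi) with (sin phi / cos phi * cos phi) by (field; lra).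
  rewrite Ht; field; lra.
Qed.

Lemma ray_connection_finite (lam : R) (Q : R * R -> R * R) (d : R * R) :
  homogeneous_quadratic Q -> 0 < lam -> zero_direction Q d -> radial Q d < 0 ->
  connection lam Q origin (finite_equilibrium lam Q d).
Proof.
  intros HQ Hlam Hd HF; assert (HPI := PI_RGT_0).
  unfold finite_equilibrium.
  destruct (finite_angle lam (radial Q d) Hlam HF) as [Hphi E].
  set (phi1 := atan _) in *.
  apply ray_connection_to; auto; [lra|rewrite E; ring|].
  intros phi Hphi'.
  assert (0 < sin phi) by (apply sin_gt_0; lra).
  assert (0 < cos phi) by (apply cos_gt_0; lra).
  apply Rmult_lt_0_compat; [now apply Rmult_lt_0_compat|].
  assert (H1 : 0 < sin phi1) by (apply sin_gt_0; lra).
  assert (H2 : 0 < sin (phi1 - phi)) by (apply sin_gt_0; lra).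
  rewrite sin_minus in H2.
  apply Rmult_lt_reg_r with (sin phi1); [exact H1|].
  replace ((lam * cos phi + radial Q d * sin phi) * sin phi1)
    with (lam * (sin phi1 * cos phi) + radial Q d * sin phi1 * sin phi) by ring.
  replace (radial Q d * sin phi1) with (- lam * cos phi1) by lra.
  rewrite Rmult_0_l; nra.
Qed.

Definition boundary_point (theta : R) : R * R := (cos theta, sin theta).

Lemma calG_boundary_bounded_lipschitz (Q : R * R -> R * R) :
  homogeneous_quadratic Q ->
  bounded_lipschitz (fun theta => calG Q (cos theta) (sin theta)).
Proof.
  intros (a & b & c & a' & b' & c' & HQ).
  apply (bounded_lipschitz_ext (fun x =>
    cos x * (a' * (cos x * cos x) + b' * (cos x * sin x) + c' * (sin x * sin x))
    + (- 1) * (sin x * (a * (cos x * cos x) + b * (cos x * sin x)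
                        + c * (sin x * sin x))))).
  { intros x; unfold calG; rewrite HQ; cbn [fst snd]; ring. }
  repeat first
    [ apply bounded_lipschitz_const | apply bounded_lipschitz_cos
    | apply bounded_lipschitz_sin | apply bounded_lipschitz_plus
    | apply bounded_lipschitz_mult ].
Qed.

(** The circle at infinity carries the flow [theta' = calG Q (cos theta) (sin theta)]. *)
Lemma compactified_field_boundary (lam : R) (Q : R * R -> R * R) (u v : R) :
  u ^ 2 + v ^ 2 = 1 ->
  compactified_field lam Q (u, v, 0) = (- v * calG Q u v, u * calG Q u v, 0).
Proof.
  intros H; unfold compactified_field, calG.
  destruct (Q (u, v)) as [U V]; cbn [fst snd].
  assert (Hv : v ^ 2 = 1 - u ^ 2) by lra.
  f_equal; [f_equal|ring].
  - transitivity ((1 - u ^ 2) * U - u * v * V); [|rewrite <- Hv]; ring.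
  - transitivity (u ^ 2 * V - u * v * U); [|ring].
    transitivity (V * (1 - v ^ 2) - u * v * U); [ring|rewrite Hv; ring].
Qed.

Lemma boundary_point_unit (theta : R) : cos theta ^ 2 + sin theta ^ 2 = 1.
Proof. generalize (sin2_cos2 theta); unfold Rsqr; simpl; lra. Qed.

Lemma equilibrium_at_infinity (lam : R) (Q : R * R -> R * R) (d : R * R) :
  zero_direction Q d -> equilibrium lam Q (at_infinity d).
Proof.
  destruct d as [p q]; intros [Hd HG]; cbn [fst snd] in *; apply equilibrium_iff; split.
  - split; [|right; reflexivity]. cbn [fst snd]; rewrite Hd; ring.
  - unfold at_infinity; cbn [fst snd].
    rewrite compactified_field_boundary, HG by exact Hd.
    f_equal; f_equal; ring.
Qed.

Lemma boundary_connection_of_orbit (lam : R) (Q : R * R -> R * R) (g : R -> R)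
    (theta1 theta2 : R) :
  calG Q (cos theta1) (sin theta1) = 0 -> calG Q (cos theta2) (sin theta2) = 0 ->
  boundary_point theta1 <> boundary_point theta2 ->
  (forall t, is_derive g t (calG Q (cos (g t)) (sin (g t)))) ->
  filterlim g (Rbar_locally m_infty) (locally theta1) ->
  filterlim g (Rbar_locally p_infty) (locally theta2) ->
  connection lam Q (at_infinity (boundary_point theta1))
                   (at_infinity (boundary_point theta2)).
Proof.
  intros H1 H2 Hne Hg Hm Hp.
  assert (Hc : forall x, continuous (fun theta => at_infinity (boundary_point theta)) x).
  { intros x; unfold at_infinity, boundary_point; cbn [fst snd].
    apply continuous_triple; [| |apply continuous_const];
      apply (ex_derive_continuous (V := R_NormedModule)); auto_derive; auto. }
  split; [|split; [|split]].
  - intros E; apply Hne; unfold at_infinity in E; injection E; intros.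
    unfold boundary_point; congruence.
  - apply equilibrium_at_infinity; split; [apply boundary_point_unit|exact H1].
  - apply equilibrium_at_infinity; split; [apply boundary_point_unit|exact H2].
  - exists (fun t => at_infinity (boundary_point (g t))); split; [|split].
    + apply solution_trajectory; intros t; unfold at_infinity, boundary_point.
      cbn [fst snd]; rewrite compactified_field_boundary by apply boundary_point_unit.
      cbv zeta; cbn [fst snd].
      split; [split; [rewrite boundary_point_unit; ring|right; reflexivity]|].
      split; [|split; [|apply (is_derive_const (V := R_NormedModule))]];
        (auto_derive; [eexists; exact (Hg t)|]);
        change (fun x : R => g x) with g; rewrite (is_derive_unique _ _ _ (Hg t)); ring.
    + apply (filterlim_comp _ _ _ g (fun x => at_infinity (boundary_point x)) _ (locally theta1)); [exact Hm|apply Hc].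
    + apply (filterlim_comp _ _ _ g (fun x => at_infinity (boundary_point x)) _ (locally theta2)); [exact Hp|apply Hc].
Qed.

Lemma boundary_connection (lam : R) (Q : R * R -> R * R) (theta1 theta2 : R) :
  homogeneous_quadratic Q -> theta1 < theta2 ->
  calG Q (cos theta1) (sin theta1) = 0 -> calG Q (cos theta2) (sin theta2) = 0 ->
  boundary_point theta1 <> boundary_point theta2 ->
  (forall theta, theta1 < theta < theta2 -> 0 < calG Q (cos theta) (sin theta)) ->
  connection lam Q (at_infinity (boundary_point theta1))
                   (at_infinity (boundary_point theta2)).
Proof.
  intros HQ Hlt H1 H2 Hne Hpos.
  destruct (calG_boundary_bounded_lipschitz Q HQ) as (K & HK & _ & Hf).
  destruct (scalar_orbit _ theta1 theta2 K Hlt HK Hf H1 H2 Hpos)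
    as (g & _ & Hg & Hm & Hp).
  now apply (boundary_connection_of_orbit lam Q g).
Qed.

Lemma boundary_connection_decreasing (lam : R) (Q : R * R -> R * R)
    (theta1 theta2 : R) :
  homogeneous_quadratic Q -> theta1 < theta2 ->
  calG Q (cos theta1) (sin theta1) = 0 -> calG Q (cos theta2) (sin theta2) = 0 ->
  boundary_point theta1 <> boundary_point theta2 ->
  (forall theta, theta1 < theta < theta2 -> calG Q (cos theta) (sin theta) < 0) ->
  connection lam Q (at_infinity (boundary_point theta2))
                   (at_infinity (boundary_point theta1)).
Proof.
  intros HQ Hlt H1 H2 Hne Hneg.
  destruct (calG_boundary_bounded_lipschitz Q HQ) as (K & HK & _ & Hf).
  destruct (scalar_orbit_decreasing _ theta1 theta2 K Hlt HK Hf H1 H2 Hneg)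
    as (g & _ & Hg & Hm & Hp).
  apply (boundary_connection_of_orbit lam Q g); auto.
Qed.

(** At a finite equilibrium other than the origin the quadratic part is a
    multiple of the position; at infinity only the tangential part counts. *)
Lemma equilibria (lam : R) (Q : R * R -> R * R) (m : R * R * R) :
  homogeneous_quadratic Q -> 0 < lam ->
  equilibrium lam Q m <->
  m = origin \/
  (exists d, zero_direction Q d /\ m = at_infinity d) \/
  (exists d, zero_direction Q d /\ radial Q d < 0 /\ m = finite_equilibrium lam Q d).
Proof.
  intros HQ Hlam; split.
  - intros H; apply equilibrium_iff in H as [Hd H].
    destruct m as [[u v] w]; destruct Hd as [Hd Hw].
    unfold compactified_field in H.
    destruct (Req_dec w 0) as [->|Hw0].
    + right; left; exists (u, v).
      assert (Hd' : u ^ 2 + v ^ 2 = 1) by lra.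
      split; [split; [exact Hd'|]|reflexivity].
      injection H as H1 H2 _.
      unfold calG; cbn [fst snd].
      destruct (Q (u, v)) as [U V]; cbn [fst snd] in *.
      set (s := u * (lam * 0 * u + U) + v * (lam * 0 * v + V)) in *.
      transitivity (u * (lam * 0 * v + V - v * s) - v * (lam * 0 * u + U - u * s)); [ring|].
      rewrite H1, H2; ring.
    + injection H as H1 H2 H3.
      apply Rmult_integral in H3 as [H3|H3]; [lra|].
      rewrite H3 in H1, H2.
      destruct (Req_dec (u ^ 2 + v ^ 2) 0) as [H0|H0].
      * left; assert (u = 0) by nra; assert (v = 0) by nra; subst.
        unfold origin; f_equal; nra.
      * right; right.
        set (rho := sqrt (u ^ 2 + v ^ 2)).
        assert (Hr : 0 < u ^ 2 + v ^ 2) by nra.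
        assert (Hrho : 0 < rho) by now apply sqrt_lt_R0.
        assert (Hrho2 : rho ^ 2 = u ^ 2 + v ^ 2) by (apply pow2_sqrt; lra).
        set (p := u / rho). set (q := v / rho).
        assert (Hu : u = rho * p) by (unfold p; field; lra).
        assert (Hv : v = rho * q) by (unfold q; field; lra).
        assert (Hpq : p ^ 2 + q ^ 2 = 1).
        { apply Rmult_eq_reg_l with (rho ^ 2); [|apply pow_nonzero; lra].
          rewrite Hu, Hv in Hrho2; lra. }
        clearbody p q rho; subst u v.
        rewrite homogeneous_scaling in H1, H2 by exact HQ.
        assert (HR : radial Q (p, q) = - (lam * w / rho) /\ zero_direction Q (p, q)).
        { unfold zero_direction, radial, calF, calG; cbn [fst snd].
          destruct (Q (p, q)) as [U V]; cbn [fst snd] in *.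
          assert (HU : U = - (lam * w / rho) * p).
          { apply Rmult_eq_reg_l with (rho ^ 2); [|apply pow_nonzero; lra].
            field_simplify; lra. }
          assert (HV : V = - (lam * w / rho) * q).
          { apply Rmult_eq_reg_l with (rho ^ 2); [|apply pow_nonzero; lra].
            field_simplify; lra. }
          rewrite HU, HV; split; [|split; [exact Hpq|ring]].
          transitivity (- (lam * w / rho) * (p ^ 2 + q ^ 2)); [ring|].
          rewrite Hpq; ring. }
        destruct HR as [HR Hz].
        exists (p, q); split; [exact Hz|].
        assert (0 < lam * w / rho)
          by (apply Rdiv_lt_0_compat; [apply Rmult_lt_0_compat|]; lra).
        split; [lra|].
        unfold finite_equilibrium, ray; rewrite HR.
        replace (- lam / - (lam * w / rho)) with (rho / w) by (field; lra).
        rewrite sin_atan, cos_atan.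
        replace (1 + (rho / w)²) with ((/ w) ^ 2).
        2: { unfold Rsqr; replace (1 + rho / w * (rho / w))
               with ((w ^ 2 + rho ^ 2) * / w ^ 2) by (field; lra).
             rewrite Hrho2; replace (w ^ 2 + _) with 1 by lra; field; lra. }
        assert (0 < / w) by (apply Rinv_0_lt_compat; lra).
        rewrite sqrt_pow2 by lra.
        cbn [fst snd]; f_equal; [f_equal|]; field; lra.
  - intros [->|[(d & Hd & ->)|(d & Hd & HF & ->)]].
    + apply equilibrium_iff; split; [split; lra|].
      destruct HQ as (a & b & c & a' & b' & c' & HQ).
      unfold compactified_field, origin; rewrite HQ.
      cbn [fst snd]; f_equal; [f_equal|]; ring.
    + now apply equilibrium_at_infinity.
    + now apply (ray_connection_finite lam Q d).
Qed.

Definition inward (Q : R * R -> R * R) (d : R * R) : bool :=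
  if Rlt_dec (radial Q d) 0 then true else false.

Lemma inward_spec (Q : R * R -> R * R) (d : R * R) :
  inward Q d = true <-> radial Q d < 0.
Proof. unfold inward; destruct Rlt_dec; split; try easy; contradiction. Qed.

Lemma at_infinity_inj (d d' : R * R) : at_infinity d = at_infinity d' -> d = d'.
Proof.
  destruct d, d'; unfold at_infinity; simpl; intros H; injection H; congruence.
Qed.

Lemma finite_equilibrium_height (lam : R) (Q : R * R -> R * R) (d : R * R) :
  0 < lam -> radial Q d < 0 -> 0 < snd (finite_equilibrium lam Q d) < 1.
Proof.
  intros Hlam HF; destruct (finite_angle lam _ Hlam HF) as [H _].
  unfold finite_equilibrium, ray; cbn [snd].
  split; [apply cos_gt_0; lra|rewrite <- cos_0; apply cos_decreasing_1; lra].
Qed.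

Lemma finite_equilibrium_inj (lam : R) (Q : R * R -> R * R) (d d' : R * R) :
  0 < lam -> radial Q d < 0 -> radial Q d' < 0 ->
  finite_equilibrium lam Q d = finite_equilibrium lam Q d' -> d = d'.
Proof.
  intros Hlam HF HF'; unfold finite_equilibrium, ray.
  destruct (finite_angle lam _ Hlam HF) as [H _].
  destruct (finite_angle lam _ Hlam HF') as [H' _].
  set (phi := atan _) in *. set (phi' := atan (- lam / radial Q d')) in *.
  intros E; injection E as E1 E2 E3.
  assert (0 < sin phi) by (apply sin_gt_0; lra).
  assert (0 < sin phi') by (apply sin_gt_0; lra).
  assert (Es : sin phi = sin phi').
  { apply Rsqr_inj; try lra; rewrite !sin2, E3; reflexivity. }
  rewrite <- Es in E1, E2.
  apply Rmult_eq_reg_r in E1; [|lra]; apply Rmult_eq_reg_r in E2; [|lra].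
  destruct d, d'; simpl in *; congruence.
Qed.

(** Besides the origin, each zero direction contributes its point at infinity,
    and one finite equilibrium if the radial part pulls inwards. *)
Lemma cardinal_equilibria (lam : R) (Q : R * R -> R * R) (ds : list (R * R)) :
  homogeneous_quadratic Q -> 0 < lam -> NoDup ds ->
  (forall d, zero_direction Q d <-> In d ds) ->
  has_cardinal (equilibrium lam Q) (S (length ds + length (filter (inward Q) ds))).
Proof.
  intros HQ Hlam Hds Hin.
  assert (Hneg : forall d, In d (filter (inward Q) ds) <->
    zero_direction Q d /\ radial Q d < 0)
    by (intros; rewrite filter_In, inward_spec, Hin; reflexivity).
  exists (origin :: map at_infinity ds
          ++ map (finite_equilibrium lam Q) (filter (inward Q) ds)).
  split; [|split].
  - constructor.
    + rewrite in_app_iff, !in_map_iff; intros [(d & E & _)|(d & E & Hd)].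
      * apply (f_equal snd) in E; simpl in E; lra.
      * apply Hneg in Hd as [_ HF].
        generalize (finite_equilibrium_height lam Q d Hlam HF).
        rewrite E; simpl; lra.
    + apply NoDup_app.
      * apply NoDup_map_NoDup_ForallPairs; [|exact Hds].
        intros d d' _ _; apply at_infinity_inj.
      * apply NoDup_map_NoDup_ForallPairs; [|now apply NoDup_filter].
        intros d d' Hd Hd'; apply Hneg in Hd, Hd'.
        now apply finite_equilibrium_inj.
      * intros m; rewrite !in_map_iff; intros (d & <- & _) (d' & E & Hd').
        apply Hneg in Hd' as [_ HF].
        generalize (finite_equilibrium_height lam Q d' Hlam HF).
        rewrite E; simpl; lra.
  - simpl; rewrite length_app, !length_map; reflexivity.
  - intros m; rewrite equilibria by assumption; cbn [In].
    rewrite in_app_iff, !in_map_iff.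
    split.
    + intros [->|[(d & Hd & ->)|(d & Hd & HF & ->)]]; [now left|right; left|right; right].
      * exists d; split; [reflexivity|now apply Hin].
      * exists d; split; [reflexivity|now apply Hneg].
    + intros [<-|[(d & <- & Hd)|(d & <- & Hd)]]; [now left|right; left|right; right].
      * exists d; split; [now apply Hin|reflexivity].
      * apply Hneg in Hd as [Hd HF]; exists d; auto.
Qed.

(** * Which equilibria attract a trajectory *)

Lemma increasing_le_limit (y dy : R -> R) (T l : R) :
  (forall t, is_derive y t (dy t)) -> (forall t, T < t -> 0 <= dy t) ->
  filterlim y (Rbar_locally p_infty) (locally l) ->
  forall t, T < t -> y t <= l.
Proof.
  intros Hy Hdy Hl t Ht; apply Rnot_lt_le; intros Hlt.
  destruct (Hl (fun z => z < y t)) as [T' HT']; [now apply open_lt|].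
  set (r := Rmax t T' + 1).
  assert (H1 := Rmax_l t T'). assert (H2 := Rmax_r t T').
  assert (Hr : y r < y t) by (apply HT'; unfold r; lra).
  destruct (MVT_gen y t r dy) as (c & Hc & E).
  - intros; apply Hy.
  - intros z _; apply derivable_continuous_pt; exists (dy z); apply is_derive_Reals, Hy.
  - rewrite Rmin_left in Hc by (unfold r; lra).
    assert (0 <= dy c) by (apply Hdy; lra).
    assert (0 <= dy c * (r - t)) by (apply Rmult_le_pos; unfold r; lra).
    lra.
Qed.

Lemma monotone_of_derivative (y dy : R -> R) (a b : R) :
  (forall t, is_derive y t (dy t)) -> (forall t, 0 <= dy t) -> a <= b -> y a <= y b.
Proof.
  intros Hy Hdy Hab.
  destruct (MVT_gen y a b dy) as (c & _ & E).
  - intros; apply Hy.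
  - intros z _; apply derivable_continuous_pt; exists (dy z); apply is_derive_Reals, Hy.
  - assert (0 <= dy c * (b - a)) by (apply Rmult_le_pos; [apply Hdy|lra]); lra.
Qed.

(** Uniqueness for the zero solution: [exp (- 2 C t) * y ^ 2] decreases and
    [exp (2 C t) * y ^ 2] increases. *)
Lemma vanishing_everywhere (y dy : R -> R) (C t0 : R) :
  (forall t, is_derive y t (dy t)) -> (forall t, Rabs (dy t) <= C * Rabs (y t)) ->
  y t0 = 0 -> forall t, y t = 0.
Proof.
  intros Hy Hdy H0.
  assert (Hb : forall t, - (C * y t ^ 2) <= y t * dy t <= C * y t ^ 2).
  { intros t; apply Rabs_le_between; rewrite Rabs_mult, <- (pow2_abs (y t)).
    replace (C * Rabs (y t) ^ 2) with (Rabs (y t) * (C * Rabs (y t))) by ring.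
    apply Rmult_le_compat_l; [apply Rabs_pos|apply Hdy]. }
  assert (Hsq : forall t, y t ^ 2 <= 0 -> y t = 0) by (intros; nra).
  intros t; apply Hsq; destruct (Rle_or_lt t0 t) as [Ht|Ht].
  - assert (H := monotone_of_derivative (fun t => - (y t ^ 2 * exp (- (2 * C * t))))
      (fun t => 2 * (C * y t ^ 2 - y t * dy t) * exp (- (2 * C * t))) t0 t).
    cbv beta in H; rewrite H0 in H.
    assert (He := exp_pos (- (2 * C * t))).
    cut (y t ^ 2 * exp (- (2 * C * t)) <= 0); [intros; nra|].
    apply Ropp_le_cancel; rewrite Ropp_0.
    replace 0 with (- (0 ^ 2 * exp (- (2 * C * t0)))) by ring.
    apply H; [|intros r; generalize (Hb r) (exp_pos (- (2 * C * r))); nra|exact Ht].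
    intros r; auto_derive; [eexists; apply Hy|].
    change (fun x : R => y x) with y; rewrite (is_derive_unique _ _ _ (Hy r)); ring.
  - assert (H := monotone_of_derivative (fun t => y t ^ 2 * exp (2 * C * t))
      (fun t => 2 * (C * y t ^ 2 + y t * dy t) * exp (2 * C * t)) t t0).
    cbv beta in H; rewrite H0 in H.
    assert (He := exp_pos (2 * C * t)).
    cut (y t ^ 2 * exp (2 * C * t) <= 0); [intros; nra|].
    replace 0 with (0 ^ 2 * exp (2 * C * t0)) by ring.
    apply H; [|intros r; generalize (Hb r) (exp_pos (2 * C * r)); nra|lra].
    intros r; auto_derive; [eexists; apply Hy|].
    change (fun x : R => y x) with y; rewrite (is_derive_unique _ _ _ (Hy r)); ring.
Qed.

Lemma nonvanishing_positive (y : R -> R) (t0 : R) :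
  (forall t, continuous y t) -> (forall t, y t <> 0) -> 0 < y t0 ->
  forall t, 0 < y t.
Proof.
  intros Hc Hn H0 t; apply Rnot_le_lt; intros Ht.
  destruct (IVT_gen y t0 t 0) as (x & _ & Hx).
  - intros z; apply continuity_pt_filterlim, Hc.
  - generalize (Rmin_r (y t0) (y t)) (Rmax_l (y t0) (y t)); lra.
  - now apply (Hn x).
Qed.

Lemma is_derive_linear_combination (U V : R -> R) (a b t dU dV : R) :
  is_derive U t dU -> is_derive V t dV ->
  is_derive (fun r => a * U r + b * V r) t (a * dU + b * dV).
Proof.
  intros HU HV; auto_derive.
  - split; [now exists dU|split; [now exists dV|exact I]].
  - change (fun x : R => U x) with U; change (fun x : R => V x) with V.
    rewrite (is_derive_unique _ _ _ HU), (is_derive_unique _ _ _ HV); ring.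
Qed.

Lemma is_derive_sum_of_squares (U V : R -> R) (t dU dV : R) :
  is_derive U t dU -> is_derive V t dV ->
  is_derive (fun r => U r ^ 2 + V r ^ 2) t (2 * (U t * dU + V t * dV)).
Proof.
  intros HU HV; auto_derive.
  - split; [now exists dU|split; [now exists dV|exact I]].
  - change (fun x : R => U x) with U; change (fun x : R => V x) with V.
    rewrite (is_derive_unique _ _ _ HU), (is_derive_unique _ _ _ HV); ring.
Qed.

(** The scalar product of the position with the field [(W1, W2)] from which the
    extended field is built: the height obeys [w' = - w * speed], and
    [u ^ 2 + v ^ 2] has derivative [2 * w ^ 2 * speed] on the disk. *)
Definition speed (lam : R) (Q : R * R -> R * R) (m : R * R * R) : R :=
  let '(u, v, w) := m in
  u * (lam * w * u + fst (Q (u, v))) + v * (lam * w * v + snd (Q (u, v))).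

Lemma quadratic_bound (Q : R * R -> R * R) :
  homogeneous_quadratic Q ->
  exists M, 0 <= M /\ forall u v,
    Rabs (fst (Q (u, v))) <= M * (u ^ 2 + v ^ 2) /\
    Rabs (snd (Q (u, v))) <= M * (u ^ 2 + v ^ 2).
Proof.
  intros (a & b & c & a' & b' & c' & HQ).
  assert (H : forall a b c u v, Rabs (a * u ^ 2 + b * u * v + c * v ^ 2)
    <= (Rabs a + Rabs b + Rabs c) * (u ^ 2 + v ^ 2)).
  { clear; intros a b c u v.
    eapply Rle_trans; [apply Rabs_triang|].
    eapply Rle_trans; [apply Rplus_le_compat_r, Rabs_triang|].
    rewrite !Rabs_mult, <- !RPow_abs.
    assert (Ha := Rabs_pos a). assert (Hb := Rabs_pos b). assert (Hc := Rabs_pos c).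
    rewrite <- (pow2_abs u), <- (pow2_abs v).
    generalize (Rabs_pos u) (Rabs_pos v); intros.
    set (x := Rabs u) in *. set (y := Rabs v) in *.
    assert (0 <= Rabs a * y ^ 2) by (apply Rmult_le_pos; [lra|apply pow2_ge_0]).
    assert (0 <= Rabs c * x ^ 2) by (apply Rmult_le_pos; [lra|apply pow2_ge_0]).
    assert (0 <= Rabs b * (x ^ 2 + y ^ 2 - x * y)) by (apply Rmult_le_pos; [lra|nra]).
    lra. }
  exists (Rabs a + Rabs b + Rabs c + (Rabs a' + Rabs b' + Rabs c')).
  generalize (Rabs_pos a) (Rabs_pos b) (Rabs_pos c)
    (Rabs_pos a') (Rabs_pos b') (Rabs_pos c'); intros.
  split; [lra|].
  intros u v; rewrite HQ; cbn [fst snd].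
  assert (0 <= u ^ 2 + v ^ 2) by nra.
  split; (eapply Rle_trans; [apply H|apply Rmult_le_compat_r; lra]).
Qed.

Lemma speed_estimate (lam : R) (Q : R * R -> R * R) :
  homogeneous_quadratic Q ->
  exists M, 0 <= M /\ forall u v w,
    Rabs (speed lam Q (u, v, w) - lam * w * (u ^ 2 + v ^ 2))
    <= M * (Rabs u + Rabs v) * (u ^ 2 + v ^ 2).
Proof.
  intros HQ; destruct (quadratic_bound Q HQ) as (M & HM & H).
  exists M; split; [exact HM|]; intros u v w; destruct (H u v) as [H1 H2].
  unfold speed.
  replace (_ - _) with (u * fst (Q (u, v)) + v * snd (Q (u, v))) by ring.
  eapply Rle_trans; [apply Rabs_triang|]; rewrite !Rabs_mult.
  generalize (Rabs_pos u) (Rabs_pos v); intros.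
  replace (M * _ * _) with
    (Rabs u * (M * (u ^ 2 + v ^ 2)) + Rabs v * (M * (u ^ 2 + v ^ 2))) by ring.
  apply Rplus_le_compat; apply Rmult_le_compat_l; assumption.
Qed.

Lemma disk_coordinates (u v w : R) :
  poincare_disk (u, v, w) ->
  Rabs u <= 1 /\ Rabs v <= 1 /\ 0 <= w <= 1 /\ 0 <= u ^ 2 + v ^ 2 <= 1.
Proof. intros [H Hw]; repeat split; try apply Rabs_le; nra. Qed.

Lemma speed_bound (lam : R) (Q : R * R -> R * R) :
  homogeneous_quadratic Q ->
  exists C, 0 <= C /\ forall u v w, poincare_disk (u, v, w) ->
    Rabs (speed lam Q (u, v, w)) <= C * (u ^ 2 + v ^ 2).
Proof.
  intros HQ; destruct (speed_estimate lam Q HQ) as (M & HM & H).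
  exists (Rabs lam + 2 * M); split; [generalize (Rabs_pos lam); lra|].
  intros u v w Hd; apply disk_coordinates in Hd as (Hu & Hv & Hw & Hr).
  specialize (H u v w).
  set (r := u ^ 2 + v ^ 2) in *. set (s := speed lam Q (u, v, w)) in *.
  replace s with ((s - lam * w * r) + lam * w * r) by ring.
  eapply Rle_trans; [apply Rabs_triang|].
  rewrite !Rabs_mult, (Rabs_pos_eq w), (Rabs_pos_eq r) by lra.
  generalize (Rabs_pos lam) (Rabs_pos u) (Rabs_pos v); intros.
  assert (M * (Rabs u + Rabs v) * r <= 2 * M * r)
    by (apply Rmult_le_compat_r; [lra|nra]).
  assert (Rabs lam * w * r <= Rabs lam * r)
    by (apply Rmult_le_compat_r; [lra|nra]).
  lra.
Qed.

Lemma continuous_u (m : R * R * R) : continuous (fun m => fst (fst m)) m.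
Proof. apply (continuous_comp fst fst); apply continuous_fst. Qed.

Lemma continuous_v (m : R * R * R) : continuous (fun m => snd (fst m)) m.
Proof. apply (continuous_comp fst snd); [apply continuous_fst|apply continuous_snd]. Qed.

Lemma continuous_w (m : R * R * R) : continuous (fun m => snd m) m.
Proof. apply continuous_snd. Qed.

Lemma continuous_square (f : R * R * R -> R) (m : R * R * R) :
  continuous f m -> continuous (fun m => f m ^ 2) m.
Proof.
  intros Hf; apply (continuous_mult (K := R_AbsRing) f (fun m => f m * 1)); [exact Hf|].
  apply (continuous_mult (K := R_AbsRing) f (fun _ => 1)); [exact Hf|].
  apply continuous_const.
Qed.

Ltac continuous_polynomial :=
  lazymatch goal with
  | |- continuous (fun m => fst (fst m)) _ => apply continuous_u
  | |- continuous (fun m => snd (fst m)) _ => apply continuous_v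
  | |- continuous (fun m => snd m) _ => apply continuous_w
  | |- continuous (fun m => @?f m + @?g m) _ =>
      apply (continuous_plus (V := R_NormedModule) f g); continuous_polynomial
  | |- continuous (fun m => @?f m - @?g m) _ =>
      apply (continuous_minus (V := R_NormedModule) f g); continuous_polynomial
  | |- continuous (fun m => @?f m * @?g m) _ =>
      apply (continuous_mult (K := R_AbsRing) f g); continuous_polynomial
  | |- continuous (fun m => @?f m ^ 2) _ =>
      apply (continuous_square f); continuous_polynomial
  | |- continuous (fun m => Rabs (@?f m)) _ =>
      apply (continuous_comp f Rabs); [continuous_polynomial|apply continuous_Rabs]
  | |- continuous (fun _ => ?c) _ => apply continuous_const
  end.

Lemma continuous_speed (lam : R) (Q : R * R -> R * R) (m : R * R * R) :
  homogeneous_quadratic Q -> continuous (speed lam Q) m.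
Proof.
  intros (a & b & c & a' & b' & c' & HQ).
  apply (continuous_ext (fun m : R * R * R =>
    let u := fst (fst m) in let v := snd (fst m) in let w := snd m in
    u * (lam * w * u + (a * u ^ 2 + b * u * v + c * v ^ 2))
    + v * (lam * w * v + (a' * u ^ 2 + b' * u * v + c' * v ^ 2)))).
  { intros [[u v] w]; unfold speed; rewrite HQ; reflexivity. }
  cbv zeta; continuous_polynomial.
Qed.

Lemma eventually_positive (F : (R -> Prop) -> Prop) (g : R -> R * R * R)
    (e : R * R * R) (phi : R * R * R -> R) :
  filterlim g F (locally e) -> continuous phi e -> 0 < phi e ->
  F (fun t => 0 < phi (g t)).
Proof.
  intros Hg Hphi He; apply (Hg (fun m => 0 < phi m)), (Hphi (fun z => 0 < z)).
  now apply open_gt.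
Qed.

Lemma constant_limit (F : (R -> Prop) -> Prop) (g : R -> R * R * R)
    (a e : R * R * R) :
  ProperFilter F -> filterlim g F (locally a) -> (forall t, g t = e) -> a = e.
Proof.
  intros HF Ha He.
  apply (filterlim_locally_unique (V := prod_NormedModule _
    (prod_NormedModule _ R_NormedModule R_NormedModule) R_NormedModule) (F := F) g); [exact Ha|].
  apply filterlim_ext with (fun _ : R => e); [intros; now rewrite He|apply filterlim_const].
Qed.

Lemma solution_coordinates (lam : R) (Q : R * R -> R * R) (g : R -> R * R * R) (t : R) :
  solution lam Q g ->
  exists u v w, g t = (u, v, w) /\ poincare_disk (u, v, w) /\
    is_derive (fun r => fst (fst (g r))) t
      (lam * w * u + fst (Q (u, v)) - u * speed lam Q (u, v, w)) /\
    is_derive (fun r => snd (fst (g r))) t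
      (lam * w * v + snd (Q (u, v)) - v * speed lam Q (u, v, w)) /\
    is_derive (fun r => snd (g r)) t (- w * speed lam Q (u, v, w)).
Proof.
  intros H; destruct (H t) as (Hd & H1 & H2 & H3).
  destruct (g t) as [[u v] w]; exists u, v, w; auto 6.
Qed.

Lemma infinity_invariant (lam : R) (Q : R * R -> R * R) (g : R -> R * R * R) (t0 : R) :
  homogeneous_quadratic Q -> solution lam Q g -> snd (g t0) = 0 ->
  forall t, snd (g t) = 0.
Proof.
  intros HQ Hg; destruct (speed_bound lam Q HQ) as (C & HC & Hs).
  apply (vanishing_everywhere (fun t => snd (g t))
    (fun t => - snd (g t) * speed lam Q (g t)) C).
  - intros t; destruct (solution_coordinates lam Q g t Hg) as (u & v & w & E & _ & _ & _ & H).
    rewrite E; cbn [snd].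
    exact H.
  - intros t; destruct (solution_coordinates lam Q g t Hg) as (u & v & w & -> & Hd & _).
    specialize (Hs u v w Hd); cbn [snd].
    apply disk_coordinates in Hd.
    rewrite Rabs_mult, Rabs_Ropp, Rmult_comm.
    apply Rmult_le_compat_r; [apply Rabs_pos|nra].
Qed.

(** Where [radial Q d < 0], the height increases near the point at infinity in
    direction [d]: only trajectories at infinity tend to it. *)
Lemma inward_target_at_infinity (lam : R) (Q : R * R -> R * R) (g : R -> R * R * R)
    (d : R * R) :
  homogeneous_quadratic Q -> solution lam Q g -> radial Q d < 0 ->
  filterlim g (Rbar_locally p_infty) (locally (at_infinity d)) ->
  forall t, snd (g t) = 0.
Proof.
  intros HQ Hg HF Hl.
  destruct (eventually_positive _ g _ (fun m => - speed lam Q m) Hl) as [T HT].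
  { apply (continuous_opp (V := R_NormedModule)), continuous_speed, HQ. }
  { unfold at_infinity, speed; unfold radial, calF in HF; lra. }
  apply (infinity_invariant lam Q g (T + 1) HQ Hg).
  assert (Hd := proj1 (Hg (T + 1))).
  cut (snd (g (T + 1)) <= 0).
  { destruct (g (T + 1)) as [[u v] w], Hd; cbn [snd]; lra. }
  apply (increasing_le_limit (fun t => snd (g t))
    (fun t => - snd (g t) * speed lam Q (g t)) T); [| | |lra].
  - intros t; destruct (solution_coordinates lam Q g t Hg) as (u & v & w & E & _ & _ & _ & H).
    rewrite E; cbn [snd]; exact H.
  - intros t Ht; specialize (HT t Ht).
    assert (Hdt := proj1 (Hg t)).
    destruct (g t) as [[u v] w], Hdt; cbn [snd] in *; nra.
  - apply (filterlim_comp _ _ _ g (fun m => snd m) _ (locally (at_infinity d)));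
      [exact Hl|apply continuous_w].
Qed.

(** Near the origin [speed] is dominated by [lam * w * (u ^ 2 + v ^ 2)]: the height
    decreases there, and cannot tend to its maximum. *)
Lemma origin_not_target (lam : R) (Q : R * R -> R * R) (a : R * R * R) :
  homogeneous_quadratic Q -> 0 < lam -> ~ connection lam Q a origin.
Proof.
  intros HQ Hlam Hconn; assert (Hne := proj1 Hconn); apply Hne; clear Hne.
  destruct (connection_solution _ _ _ _ Hconn) as (g & Hg & Ha & Ho).
  destruct (speed_estimate lam Q HQ) as (M & HM & HsM).
  destruct (speed_bound lam Q HQ) as (C & HC & HsC).
  destruct (eventually_positive _ g _
    (fun m => lam * snd m - M * (Rabs (fst (fst m)) + Rabs (snd (fst m)))) Ho)
    as [T HT].
  { continuous_polynomial. }
  { unfold origin; cbn [fst snd]; rewrite Rabs_R0; lra. }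
  assert (H1 : 1 <= snd (g (T + 1))).
  { apply Ropp_le_cancel.
    apply (increasing_le_limit (fun t => - snd (g t))
      (fun t => snd (g t) * speed lam Q (g t)) T); [| | |lra].
    - intros t; destruct (solution_coordinates lam Q g t Hg)
        as (u & v & w & E & _ & _ & _ & H).
      rewrite E; cbn [snd].
      replace (w * speed lam Q (u, v, w)) with (- (- w * speed lam Q (u, v, w))) by ring.
      apply (is_derive_opp (fun t => snd (g t))), H.
    - intros t Ht; specialize (HT t Ht).
      assert (Hdt := proj1 (Hg t)).
      destruct (g t) as [[u v] w]; cbn [fst snd] in *.
      specialize (HsM u v w); apply Rabs_le_between in HsM.
      apply disk_coordinates in Hdt.
      apply Rmult_le_pos; [lra|].
      assert (0 <= (lam * w - M * (Rabs u + Rabs v)) * (u ^ 2 + v ^ 2))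
        by (apply Rmult_le_pos; lra).
      lra.
    - replace (- (1)) with (- snd origin) by reflexivity.
      apply (filterlim_comp _ _ _ g (fun m => - snd m) _ (locally origin)); [exact Ho|].
      apply (continuous_opp (V := R_NormedModule)), continuous_w. }
  apply (constant_limit _ g a origin _ Ha).
  assert (H0 : forall t, fst (fst (g t)) ^ 2 + snd (fst (g t)) ^ 2 = 0).
  { apply (vanishing_everywhere
      (fun t => fst (fst (g t)) ^ 2 + snd (fst (g t)) ^ 2)
      (fun t => 2 * speed lam Q (g t)
      * (1 - (fst (fst (g t)) ^ 2 + snd (fst (g t)) ^ 2))) (2 * C) (T + 1)).
    - intros t; destruct (solution_coordinates lam Q g t Hg)
        as (u & v & w & E & _ & Du & Dv & _).
      assert (D := is_derive_sum_of_squares _ _ _ _ _ Du Dv); cbv beta in D.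
      rewrite E in D; rewrite E; cbn [fst snd] in *.
      replace (2 * speed lam Q (u, v, w) * (1 - (u ^ 2 + v ^ 2))) with
        (2 * (u * (lam * w * u + fst (Q (u, v)) - u * speed lam Q (u, v, w))
              + v * (lam * w * v + snd (Q (u, v)) - v * speed lam Q (u, v, w))));
        [exact D|].
      transitivity (2 * (u * (lam * w * u + fst (Q (u, v))) + v * (lam * w * v + snd (Q (u, v))))
        - 2 * (u ^ 2 + v ^ 2) * speed lam Q (u, v, w)); [ring|].
      change (u * (lam * w * u + fst (Q (u, v))) + v * (lam * w * v + snd (Q (u, v))))
        with (speed lam Q (u, v, w)); ring.
    - intros t; assert (Hdt := proj1 (Hg t)).
      destruct (g t) as [[u v] w]; cbn [fst snd].
      specialize (HsC u v w Hdt); apply disk_coordinates in Hdt.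
      set (r := u ^ 2 + v ^ 2) in *.
      rewrite !Rabs_mult, (Rabs_pos_eq 2), (Rabs_pos_eq r), (Rabs_pos_eq (1 - r)) by lra.
      assert (Rabs (speed lam Q (u, v, w)) * (1 - r) <= C * r * 1).
      { apply Rmult_le_compat; try lra; apply Rabs_pos. }
      lra.
    - assert (Hdt := proj1 (Hg (T + 1))).
      destruct (g (T + 1)) as [[u v] w], Hdt; cbn [fst snd] in *; nra. }
  intros t; specialize (H0 t); assert (Hdt := proj1 (Hg t)).
  destruct (g t) as [[u v] w], Hdt; cbn [fst snd] in *.
  assert (u = 0) by nra; assert (v = 0) by nra; subst.
  unfold origin; f_equal; nra.
Qed.

(** The point [d] of the circle at infinity is repelling within the circle.
    [fst d * v - snd d * u] is the sine of the angle from [d] to [(u, v)]; the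
    second alternative covers multiple zeros of [calG]. *)
Definition repelling (Q : R * R -> R * R) (d : R * R) : Prop :=
  exists al be ga,
    (forall u v, calG Q u v =
       (fst d * v - snd d * u) * (al * (u * u) + be * (u * v) + ga * (v * v))) /\
    (0 < al * (fst d * fst d) + be * (fst d * snd d) + ga * (snd d * snd d) \/
     forall u v, 0 <= al * (u * u) + be * (u * v) + ga * (v * v)).

Lemma solution_at_infinity (lam : R) (Q : R * R -> R * R) (g : R -> R * R * R) :
  solution lam Q g -> (forall t, snd (g t) = 0) ->
  forall t, exists u v, g t = (u, v, 0) /\ u ^ 2 + v ^ 2 = 1 /\
    is_derive (fun r => fst (fst (g r))) t (- v * calG Q u v) /\
    is_derive (fun r => snd (fst (g r))) t (u * calG Q u v).
Proof.
  intros Hg Hw t; destruct (Hg t) as (Hd & H1 & H2 & _).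
  specialize (Hw t); destruct (g t) as [[u v] w]; cbn [snd] in Hw; subst w.
  exists u, v.
  assert (Huv : u ^ 2 + v ^ 2 = 1) by (destruct Hd; lra).
  rewrite compactified_field_boundary in H1, H2 by exact Huv.
  auto.
Qed.

(** A trajectory tending to such a point would stay in the circle at infinity,
    where the distance to a repelling point increases: it would be at rest. *)
Lemma repelling_inward_not_target (lam : R) (Q : R * R -> R * R) (a : R * R * R)
    (d : R * R) :
  homogeneous_quadratic Q -> zero_direction Q d -> repelling Q d ->
  radial Q d < 0 -> ~ connection lam Q a (at_infinity d).
Proof.
  intros HQ [Hd _] (al & be & ga & HG & HK) HF Hconn.
  assert (Hne := proj1 Hconn); apply Hne; clear Hne.
  destruct (connection_solution _ _ _ _ Hconn) as (g & Hg & Ha & Hl).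
  assert (Hw := inward_target_at_infinity lam Q g d HQ Hg HF Hl).
  assert (Hs := solution_at_infinity lam Q g Hg Hw).
  destruct d as [p q]; cbn [fst snd] in *.
  set (K := fun u v => al * (u * u) + be * (u * v) + ga * (v * v)) in *.
  set (l := fun t => - q * fst (fst (g t)) + p * snd (fst (g t))).
  set (x := fun t => p * fst (fst (g t)) + q * snd (fst (g t))).
  set (k := fun t => x t * K (fst (fst (g t))) (snd (fst (g t)))).
  assert (Hl' : forall t, is_derive l t (k t * l t)).
  { intros t; destruct (Hs t) as (u & v & E & _ & Du & Dv).
    assert (D := is_derive_linear_combination _ _ (- q) p _ _ _ Du Dv).
    unfold l, k, x; rewrite E; cbn [fst snd].
    rewrite HG in D; fold (K u v) in D.
    replace (_ * _) with (- q * (- v * ((p * v - q * u) * K u v))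
      + p * (u * ((p * v - q * u) * K u v))) by ring.
    exact D. }
  assert (Hev : Rbar_locally p_infty (fun t => 0 <= K (fst (fst (g t))) (snd (fst (g t))))).
  { destruct HK as [HK|HK].
    - generalize (eventually_positive _ g _ (fun m => K (fst (fst m)) (snd (fst m))) Hl).
      intros H; apply filter_imp with (2 := H ltac:(unfold K; continuous_polynomial) HK).
      intros; lra.
    - exists 0; intros; apply HK. }
  destruct (eventually_positive _ g _ (fun m => p * fst (fst m) + q * snd (fst m)) Hl)
    as [T1 HT1]; [continuous_polynomial|unfold at_infinity; cbn [fst snd]; simpl in Hd; lra|].
  destruct Hev as [T2 HT2].
  set (T := Rmax T1 T2).
  assert (HT1' := Rmax_l T1 T2). assert (HT2' := Rmax_r T1 T2). fold T in HT1', HT2'.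
  assert (H0 : l (T + 1) = 0).
  { cut (l (T + 1) ^ 2 <= 0); [nra|].
    apply (increasing_le_limit (fun t => l t ^ 2) (fun t => 2 * k t * l t ^ 2) T); [| | |lra].
    - intros t; auto_derive; [eexists; apply Hl'|].
      change (fun x : R => l x) with l; rewrite (is_derive_unique _ _ _ (Hl' t)); ring.
    - intros t Ht; assert (0 < x t) by (apply HT1; lra).
      assert (0 <= K (fst (fst (g t))) (snd (fst (g t)))) by (apply HT2; lra).
      assert (0 <= k t) by (apply Rmult_le_pos; lra).
      apply Rmult_le_pos; [lra|apply pow2_ge_0].
    - unfold l.
      replace 0 with ((fun m => (- q * fst (fst m) + p * snd (fst m)) ^ 2) (at_infinity (p, q)))
        by (unfold at_infinity; cbn [fst snd]; ring).
      apply (filterlim_comp _ _ _ g (fun m => (- q * fst (fst m) + p * snd (fst m)) ^ 2) _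
        (locally (at_infinity (p, q)))); [exact Hl|].
      cut (continuous (fun m : R * R * R => (- q * fst (fst m) + p * snd (fst m)) ^ 2)
        (at_infinity (p, q))); [easy|continuous_polynomial]. }
  assert (Hl0 : forall t, l t = 0).
  { apply (vanishing_everywhere l (fun t => k t * l t)
      (2 * (Rabs al + Rabs be + Rabs ga)) (T + 1) Hl'); [|exact H0].
    intros t; rewrite Rabs_mult; apply Rmult_le_compat_r; [apply Rabs_pos|].
    destruct (Hs t) as (u & v & E & Huv & _); unfold k, x; rewrite E; cbn [fst snd].
    unfold K; rewrite Rabs_mult.
    assert (Hp : Rabs p <= 1 /\ Rabs q <= 1 /\ Rabs u <= 1 /\ Rabs v <= 1)
      by (repeat split; apply Rabs_le; nra).
    apply Rmult_le_compat; try apply Rabs_pos.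
    - generalize (pow2_ge_0 (p - u)) (pow2_ge_0 (q - v)) (pow2_ge_0 (p + u))
        (pow2_ge_0 (q + v)); intros; apply Rabs_le; simpl in *; lra.
    - eapply Rle_trans; [apply Rabs_triang|].
      eapply Rle_trans; [apply Rplus_le_compat_r, Rabs_triang|].
      rewrite !Rabs_mult.
      assert (H : forall c x y, 0 <= c -> 0 <= x <= 1 -> 0 <= y <= 1 -> c * (x * y) <= c)
        by (intros c y z Hc Hy Hz; assert (y * z <= 1) by nra; nra).
      generalize (Rabs_pos al) (Rabs_pos be) (Rabs_pos ga) (Rabs_pos u) (Rabs_pos v); intros.
      generalize (H (Rabs al) (Rabs u) (Rabs u)) (H (Rabs be) (Rabs u) (Rabs v))
        (H (Rabs ga) (Rabs v) (Rabs v)); lra. }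
  (* [x] is the cosine of the angle from [d]; it is [1] or [-1], and [1] at late times. *)
  assert (Hx2 : forall t, x t ^ 2 = 1).
  { intros t; destruct (Hs t) as (u & v & E & Huv & _).
    generalize (Hl0 t); unfold l, x; rewrite E; cbn [fst snd]; intros H.
    transitivity ((p ^ 2 + q ^ 2) * (u ^ 2 + v ^ 2) - (- q * u + p * v) ^ 2); [ring|].
    rewrite Hd, Huv, H; ring. }
  assert (Hx : forall t, 0 < x t).
  { apply (nonvanishing_positive x (T + 1)).
    - intros t; destruct (Hs t) as (u & v & E & _ & Du & Dv).
      apply (ex_derive_continuous (V := R_NormedModule)); eexists.
      apply (is_derive_linear_combination _ _ p q _ _ _ Du Dv).
    - intros t H; generalize (Hx2 t); rewrite H; simpl; lra.
    - apply HT1; lra. }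
  apply (constant_limit _ g a (at_infinity (p, q)) _ Ha).
  intros t; destruct (Hs t) as (u & v & E & _).
  generalize (Hl0 t) (Hx t) (Hx2 t); unfold l, x; rewrite E; unfold at_infinity;
    cbn [fst snd]; intros E1 E2 E3.
  assert (E2' : p * u + q * v = 1) by nra.
  f_equal; f_equal.
  - transitivity ((p ^ 2 + q ^ 2) * u); [rewrite Hd; ring|].
    transitivity (p * (p * u + q * v) - q * (- q * u + p * v)); [ring|].
    rewrite E1, E2'; ring.
  - transitivity ((p ^ 2 + q ^ 2) * v); [rewrite Hd; ring|].
    transitivity (q * (p * u + q * v) + p * (- q * u + p * v)); [ring|].
    rewrite E1, E2'; ring.
Qed.

(** [dr] and [dc] list the zeros of [calG] on the circle at infinity: those
    repelling within the circle, and those to which a trajectory in the circle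
    tends.  As the flow in the circle is that of [calG], the same lists serve all
    members of a family of canonical forms. *)
Definition boundary_flow (lam : R) (Q : R * R -> R * R) (dr dc : list (R * R)) : Prop :=
  NoDup (dr ++ dc) /\
  (forall d, zero_direction Q d <-> In d (dr ++ dc)) /\
  (forall d, In d dr -> repelling Q d) /\
  (forall d, In d dc -> exists a, connection lam Q a (at_infinity d)).

(** Every equilibrium that is not listed is the end of a trajectory along a ray
    from the origin, or along an arc at infinity. *)
Lemma sources (lam : R) (Q : R * R -> R * R) (dr dc : list (R * R)) (m : R * R * R) :
  homogeneous_quadratic Q -> 0 < lam -> boundary_flow lam Q dr dc ->
  source lam Q m <-> In m (origin :: map at_infinity (filter (inward Q) dr)).
Proof.
  intros HQ Hlam (_ & Hz & Hr & Hc); cbn [In]; rewrite in_map_iff; split.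
  - intros [Hm Hs]; apply equilibria in Hm as [->|[(d & Hd & ->)|(d & Hd & HF & ->)]];
      try assumption; [now left| |].
    + right; exists d; split; [reflexivity|]; apply filter_In.
      destruct (Rlt_dec (radial Q d) 0) as [HF|HF].
      * split; [|now apply inward_spec].
        apply Hz, in_app_or in Hd as [Hd|Hd]; [exact Hd|].
        exfalso; destruct (Hc d Hd) as [a Ha]; now apply (Hs a).
      * exfalso; apply (Hs origin), ray_connection_infinity; auto; lra.
    + exfalso; apply (Hs origin), ray_connection_finite; auto.
  - intros [<-|(d & <- & Hd)].
    + split; [apply equilibria; auto|intros a; now apply origin_not_target].
    + apply filter_In in Hd as [Hd HF]; apply inward_spec in HF.
      assert (Hzd : zero_direction Q d) by (apply Hz, in_or_app; now left).
      split; [now apply equilibrium_at_infinity|].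
      intros a; apply repelling_inward_not_target; auto.
Qed.

Lemma cardinal_sources (lam : R) (Q : R * R -> R * R) (dr dc : list (R * R)) :
  homogeneous_quadratic Q -> 0 < lam -> boundary_flow lam Q dr dc ->
  has_cardinal (source lam Q) (S (length (filter (inward Q) dr))).
Proof.
  intros HQ Hlam Hb.
  exists (origin :: map at_infinity (filter (inward Q) dr)).
  split; [|split; [simpl; now rewrite length_map|intros; now apply (sources lam Q dr dc)]].
  constructor.
  - rewrite in_map_iff; intros (d & E & _); apply (f_equal snd) in E; simpl in E; lra.
  - apply NoDup_map_NoDup_ForallPairs; [intros d d' _ _; apply at_infinity_inj|].
    apply NoDup_filter, (NoDup_app_remove_r _ _ (proj1 Hb)).
Qed.

(** * Counting in the families [form_iv], [form_iii] and [form_ii] *)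

Definition portrait_counts (lam : R) (Q : R * R -> R * R) (n s : nat) : Prop :=
  has_cardinal (equilibrium lam Q) n /\ has_cardinal (source lam Q) s.

Lemma boundary_flow_counts (lam : R) (Q : R * R -> R * R) (dr dc : list (R * R))
    (ir ic : nat) :
  homogeneous_quadratic Q -> 0 < lam -> boundary_flow lam Q dr dc ->
  length (filter (inward Q) dr) = ir -> length (filter (inward Q) dc) = ic ->
  portrait_counts lam Q (S (length dr + length dc + (ir + ic))) (S ir).
Proof.
  intros HQ Hlam Hb Hr Hc; split.
  - rewrite <- Hr, <- Hc, <- (length_app dr), <- (length_app (filter _ dr)), <- filter_app.
    apply cardinal_equilibria; auto; apply Hb.
  - rewrite <- Hr; now apply (cardinal_sources lam Q dr dc).
Qed.

Lemma canonical_homogeneous (f : form) (q1 q2 : R) :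
  homogeneous_quadratic (canonical f q1 q2).
Proof.
  destruct f.
  - exists q1, q2, (-1), 1, q1, q2; intros; simpl; f_equal; ring.
  - exists q1, (q2 + 3), 0, 1, q1, q2; intros; simpl; f_equal; ring.
  - exists q1, q2, 0, 0, (q1 + 3), q2; intros; simpl; f_equal; ring.
  - exists q1, q2, 0, 1, q1, q2; intros; simpl; f_equal; ring.
  - exists q1, q2, 0, 0, q1, q2; intros; simpl; f_equal; ring.
Qed.

Lemma square_eq_cases (x y : R) : x ^ 2 = y ^ 2 -> x = y \/ x = - y.
Proof.
  intros H; assert (H' : (x - y) * (x + y) = 0) by (ring_simplify; lra).
  apply Rmult_integral in H' as []; [left|right]; lra.
Qed.

Lemma boundary_point_0 : boundary_point 0 = (1, 0).
Proof. unfold boundary_point; now rewrite cos_0, sin_0. Qed.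

Lemma boundary_point_PI2 : boundary_point (PI / 2) = (0, 1).
Proof. unfold boundary_point; now rewrite cos_PI2, sin_PI2. Qed.

Lemma boundary_point_PI : boundary_point PI = (-1, 0).
Proof. unfold boundary_point; now rewrite cos_PI, sin_PI. Qed.

Lemma boundary_point_opp (theta : R) :
  boundary_point (- theta) =
  (fst (boundary_point theta), - snd (boundary_point theta)).
Proof. unfold boundary_point; now rewrite cos_neg, sin_neg. Qed.

Ltac distinct_directions :=
  intros E; injection E; intros; lra.

Lemma boundary_flow_iv (lam q1 q2 : R) :
  boundary_flow lam (canonical form_iv q1 q2) [(0, -1)] [(0, 1)].
Proof.
  assert (HPI := PI_RGT_0).
  split; [|split; [|split]].
  - repeat constructor; simpl; [|easy]; intros [E|[]]; injection E; lra.
  - intros [p q]; unfold zero_direction; rewrite calG_canonical; simpl; split.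
    + intros [H1 H2].
      assert (Hp : p = 0) by (destruct (Req_dec p 0) as [|Hp]; [assumption|];
        exfalso; apply (pow_nonzero p 3 Hp); exact H2).
      subst p; destruct (square_eq_cases q 1) as [->| ->]; [simpl; lra| |]; auto.
    + intros [E|[E|[]]]; injection E; intros; subst; split; ring.
  - intros d [<-|[]]; exists 1, 0, 0; split.
    + intros u v; rewrite calG_canonical; simpl; ring.
    + right; intros u v; nra.
  - intros d [<-|[]]; exists (at_infinity (0, -1)).
    replace (0, -1) with (boundary_point (- (PI / 2)))
      by (rewrite boundary_point_opp, boundary_point_PI2; reflexivity).
    rewrite <- boundary_point_PI2.
    apply boundary_connection; try apply canonical_homogeneous; try lra;
      rewrite ?calG_canonical.
    + rewrite cos_neg, cos_PI2; simpl; ring.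
    + rewrite cos_PI2; simpl; ring.
    + rewrite boundary_point_opp, boundary_point_PI2; distinct_directions.
    + intros theta Ht; rewrite calG_canonical; apply pow_lt, cos_gt_0; lra.
Qed.

Lemma arcs_iii (lam q1 q2 : R) :
  let C d d' := connection lam (canonical form_iii q1 q2) (at_infinity d) (at_infinity d') in
  C (1, 0) (0, 1) /\ C (0, 1) (-1, 0) /\ C (1, 0) (0, -1) /\ C (0, -1) (-1, 0).
Proof.
  assert (HPI := PI_RGT_0).
  assert (E1 := boundary_point_0). assert (E2 := boundary_point_PI2).
  assert (E3 := boundary_point_PI).
  assert (E4 : boundary_point (- (PI / 2)) = (0, -1))
    by (rewrite boundary_point_opp, E2; reflexivity).
  assert (E5 : boundary_point (- PI) = (-1, 0))
    by (rewrite boundary_point_opp, E3; simpl; now rewrite Ropp_0).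
  assert (HC : forall theta, cos theta <> 0 -> 0 < 3 * cos theta ^ 2).
  { intros theta H; generalize (pow2_gt_0 (cos theta) H); lra. }
  assert (HG : forall theta, calG (canonical form_iii q1 q2) (cos theta) (sin theta)
    = 3 * cos theta ^ 2 * sin theta) by (intros; apply calG_canonical).
  assert (HQ := canonical_homogeneous form_iii q1 q2).
  split; [|split; [|split]].
  - rewrite <- E1, <- E2; apply boundary_connection; auto; try lra; try rewrite !HG.
    + rewrite sin_0; ring.
    + rewrite cos_PI2; ring.
    + rewrite E1, E2; distinct_directions.
    + intros theta Ht; rewrite HG; apply Rmult_lt_0_compat.
      * apply HC, Rgt_not_eq, cos_gt_0; lra.
      * apply sin_gt_0; lra.
  - rewrite <- E3, <- E2; apply boundary_connection; auto; try lra; try rewrite !HG.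
    + rewrite cos_PI2; ring.
    + rewrite sin_PI; ring.
    + rewrite E3, E2; distinct_directions.
    + intros theta Ht; rewrite HG; apply Rmult_lt_0_compat.
      * apply HC, Rlt_not_eq, cos_lt_0; lra.
      * apply sin_gt_0; lra.
  - rewrite <- E1, <- E4; apply boundary_connection_decreasing; auto; try lra;
      try rewrite !HG.
    + rewrite cos_neg, cos_PI2; ring.
    + rewrite sin_0; ring.
    + rewrite E1, E4; distinct_directions.
    + intros theta Ht; rewrite HG.
      assert (0 < 3 * cos theta ^ 2) by (apply HC, Rgt_not_eq, cos_gt_0; lra).
      assert (sin theta < 0) by (apply sin_lt_0_var; lra).
      nra.
  - rewrite <- E5, <- E4; apply boundary_connection_decreasing; auto; try lra;
      try rewrite !HG.
    + rewrite sin_neg, sin_PI; ring.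
    + rewrite cos_neg, cos_PI2; ring.
    + rewrite E4, E5; distinct_directions.
    + intros theta Ht; rewrite HG.
      assert (0 < 3 * cos theta ^ 2).
      { apply HC, Rlt_not_eq; rewrite <- cos_neg; apply cos_lt_0; lra. }
      assert (sin theta < 0) by (apply sin_lt_0_var; lra).
      nra.
Qed.

Lemma boundary_flow_iii (lam q1 q2 : R) :
  boundary_flow lam (canonical form_iii q1 q2)
    [(1, 0)] [(0, 1); (-1, 0); (0, -1)].
Proof.
  destruct (arcs_iii lam q1 q2) as (A1 & A2 & A3 & A4).
  split; [|split; [|split]].
  - repeat constructor; simpl; intuition;
      match goal with H : (_, _) = (_, _) |- _ => injection H; lra end.
  - intros [p q]; unfold zero_direction; rewrite calG_canonical; simpl; split.
    + intros [H1 H2].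
      destruct (Req_dec p 0) as [->|Hp].
      * destruct (square_eq_cases q 1) as [->| ->]; [simpl; lra| |]; auto.
      * assert (q = 0).
        { apply Rmult_integral in H2 as [H2|H2]; [|exact H2].
          exfalso; apply Hp; nra. }
        subst q; destruct (square_eq_cases p 1) as [->| ->]; [simpl; lra| |]; auto.
    + intros [E|[E|[E|[E|[]]]]]; injection E; intros; subst; split; ring.
  - intros d [<-|[]]; exists 3, 0, 0; split.
    + intros u v; rewrite calG_canonical; simpl; ring.
    + right; intros u v; nra.
  - intros d [<-|[<-|[<-|[]]]]; eexists; eassumption.
Qed.

(** The zero directions of [calG] for [form_ii] are the odd multiples of 30
    degrees, because there [calG] is [cos (3 theta)] on the unit circle. *)
Definition cos30 : R := sqrt 3 / 2.

Lemma cos30_spec : cos30 ^ 2 = 3 / 4 /\ 3 / 4 < cos30.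
Proof.
  assert (H : sqrt 3 ^ 2 = 3) by (apply pow2_sqrt; lra).
  assert (H0 := sqrt_pos 3).
  unfold cos30; split; [field_simplify; rewrite H; lra|].
  destruct (Rlt_or_le (3 / 2) (sqrt 3)) as [|]; [lra|nra].
Qed.

Lemma calG_ii_angle (q1 q2 theta : R) :
  calG (canonical form_ii q1 q2) (cos theta) (sin theta) = cos (3 * theta).
Proof.
  rewrite calG_canonical; simpl canonical_G.
  replace (3 * theta) with (2 * theta + theta) by ring.
  rewrite cos_plus, cos_2a, sin_2a; ring.
Qed.

Lemma boundary_flow_ii (lam q1 q2 : R) :
  boundary_flow lam (canonical form_ii q1 q2)
    [(0, 1); (- cos30, - (1 / 2)); (cos30, - (1 / 2))]
    [(0, -1); (cos30, 1 / 2); (- cos30, 1 / 2)].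
Proof.
  destruct cos30_spec as [Hh2 Hh].
  assert (HPI := PI_RGT_0).
  split; [|split; [|split]].
  - repeat constructor; simpl; intuition;
      match goal with H : (_, _) = (_, _) |- _ => injection H; lra end.
  - intros [p q]; unfold zero_direction; rewrite calG_canonical; cbn [fst snd]; split.
    + intros [H1 H2]; simpl canonical_G in H2.
      apply Rmult_integral in H2 as [->|H2].
      * destruct (square_eq_cases q 1) as [->| ->]; [simpl in *; lra| |]; simpl; auto.
      * destruct (square_eq_cases q (1 / 2)) as [->| ->]; [nra| |];
          (destruct (square_eq_cases p cos30) as [->| ->]; [nra| |]); simpl; auto 10.
    + intros Hin; simpl in Hin.
      destruct Hin as [E|[E|[E|[E|[E|[E|[]]]]]]]; injection E; intros; subst;
        simpl canonical_G; split; nra.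
  - intros d [<-|[<-|[<-|[]]]]; unfold repelling; cbn [fst snd].
    + exists (-1), 0, 3; split; [|left; lra].
      intros u v; rewrite calG_canonical; simpl; ring.
    + exists 2, (4 * cos30), 0; split; [|left; nra].
      intros u v; rewrite calG_canonical; simpl canonical_G.
      transitivity (u * (u ^ 2 - 4 * cos30 ^ 2 * v ^ 2)); [rewrite Hh2; field|]; field.
    + exists 2, (- 4 * cos30), 0; split; [|left; nra].
      intros u v; rewrite calG_canonical; simpl canonical_G.
      transitivity (u * (u ^ 2 - 4 * cos30 ^ 2 * v ^ 2)); [rewrite Hh2; field|]; field.
  - assert (E1 : boundary_point (PI / 6) = (cos30, 1 / 2))
      by (unfold boundary_point; now rewrite cos_PI6, sin_PI6).
    assert (E2 : boundary_point (- (PI / 6)) = (cos30, - (1 / 2)))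
      by (rewrite boundary_point_opp, E1; reflexivity).
    assert (E3 : boundary_point (5 * (PI / 6)) = (- cos30, 1 / 2)).
    { unfold boundary_point; replace (5 * (PI / 6)) with (- (PI / 6) + PI) by field.
      rewrite neg_cos, neg_sin, cos_neg, sin_neg, cos_PI6, sin_PI6, Ropp_involutive.
      reflexivity. }
    assert (E4 := boundary_point_PI2).
    assert (E5 : boundary_point (- (PI / 2)) = (0, -1))
      by (rewrite boundary_point_opp, E4; reflexivity).
    assert (HQ := canonical_homogeneous form_ii q1 q2).
    assert (C3 : cos (3 * (PI / 2)) = 0).
    { replace (3 * (PI / 2)) with (PI / 2 + PI) by field.
      rewrite neg_cos, cos_PI2; ring. }
    intros d [<-|[<-|[<-|[]]]].
    + exists (at_infinity (cos30, - (1 / 2))).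
      rewrite <- E2, <- E5; apply boundary_connection_decreasing; auto; try lra;
        rewrite ?calG_ii_angle.
      * replace (3 * - (PI / 2)) with (- (3 * (PI / 2))) by ring.
        now rewrite cos_neg.
      * replace (3 * - (PI / 6)) with (- (PI / 2)) by field.
        now rewrite cos_neg, cos_PI2.
      * rewrite E2, E5; distinct_directions.
      * intros theta Ht; rewrite calG_ii_angle, <- cos_neg; apply cos_lt_0; lra.
    + exists (at_infinity (cos30, - (1 / 2))).
      rewrite <- E1, <- E2; apply boundary_connection; auto; try lra;
        rewrite ?calG_ii_angle.
      * replace (3 * - (PI / 6)) with (- (PI / 2)) by field.
        now rewrite cos_neg, cos_PI2.
      * replace (3 * (PI / 6)) with (PI / 2) by field. apply cos_PI2.
      * rewrite E1, E2; distinct_directions.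
      * intros theta Ht; rewrite calG_ii_angle; apply cos_gt_0; lra.
    + exists (at_infinity (0, 1)).
      rewrite <- E3, <- E4; apply boundary_connection; auto; try lra;
        rewrite ?calG_ii_angle.
      * exact C3.
      * replace (3 * (5 * (PI / 6))) with (PI / 2 + 2 * INR 1 * PI) by (simpl; field).
        rewrite cos_period; apply cos_PI2.
      * rewrite E3, E4; distinct_directions.
      * intros theta Ht; rewrite calG_ii_angle.
        replace (3 * theta) with (3 * theta - 2 * PI + 2 * INR 1 * PI) by (simpl; ring).
        rewrite cos_period; apply cos_gt_0; lra.
Qed.

Lemma radial_canonical (f : form) (q1 q2 : R) (d : R * R) :
  radial (canonical f q1 q2) d = canonical_F f q1 q2 (fst d) (snd d).
Proof. apply calF_canonical. Qed.

Ltac count_inward :=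
  cbn [filter]; unfold inward; rewrite !radial_canonical; cbn [fst snd canonical_F];
  repeat (destruct Rlt_dec; try lra); reflexivity.

Lemma counts_iv (lam : R) : 0 < lam ->
  portrait_counts lam (canonical form_iv 0 0) 3 1 /\
  portrait_counts lam (canonical form_iv 0 1) 4 2 /\
  portrait_counts lam (canonical form_iv 0 (-1)) 4 1.
Proof.
  intros Hlam.
  split; [|split].
  1: apply (boundary_flow_counts lam _ _ _ 0 0 (canonical_homogeneous _ _ _) Hlam (boundary_flow_iv _ _ _)).
  3: apply (boundary_flow_counts lam _ _ _ 1 0 (canonical_homogeneous _ _ _) Hlam (boundary_flow_iv _ _ _)).
  5: apply (boundary_flow_counts lam _ _ _ 0 1 (canonical_homogeneous _ _ _) Hlam (boundary_flow_iv _ _ _)).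
  all: count_inward.
Qed.

Lemma counts_iii (lam : R) : 0 < lam ->
  portrait_counts lam (canonical form_iii 0 0) 5 1 /\
  portrait_counts lam (canonical form_iii (-1) 0) 6 2 /\
  portrait_counts lam (canonical form_iii 1 0) 6 1 /\
  portrait_counts lam (canonical form_iii 0 (-1)) 6 1 /\
  portrait_counts lam (canonical form_iii (-1) (-1)) 7 2 /\
  portrait_counts lam (canonical form_iii 1 (-1)) 7 1.
Proof.
  intros Hlam.
  assert (H := fun q1 q2 ir ic => boundary_flow_counts lam _ _ _ ir ic
    (canonical_homogeneous form_iii q1 q2) Hlam (boundary_flow_iii lam q1 q2)).
  split; [|split; [|split; [|split; [|split]]]].
  1: apply (H _ _ 0%nat 0%nat). 3: apply (H _ _ 1%nat 0%nat).
  5: apply (H _ _ 0%nat 1%nat). 7: apply (H _ _ 0%nat 1%nat).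
  9: apply (H _ _ 1%nat 1%nat). 11: apply (H _ _ 0%nat 2%nat).
  all: count_inward.
Qed.

(** At the three repelling directions the radial part takes values with sum [-3],
    and otherwise arbitrary. *)
Lemma radial_ii (q1 q2 : R) :
  let F p q := radial (canonical form_ii q1 q2) (p, q) in
  F 0 1 = q2 /\ F 0 (-1) = - q2 /\
  F cos30 (1 / 2) = q1 * cos30 + (q2 + 3) / 2 /\
  F (- cos30) (- (1 / 2)) = - (q1 * cos30 + (q2 + 3) / 2) /\
  F (- cos30) (1 / 2) = - q1 * cos30 + (q2 + 3) / 2 /\
  F cos30 (- (1 / 2)) = q1 * cos30 - (q2 + 3) / 2.
Proof.
  cbv beta zeta; rewrite !radial_canonical; cbn [fst snd canonical_F].
  destruct cos30_spec as [H _].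
  assert (H3 : cos30 ^ 3 = 3 / 4 * cos30) by (rewrite <- H; ring).
  replace ((- cos30) ^ 3) with (- (cos30 ^ 3)) by ring.
  replace ((- cos30) ^ 2) with (cos30 ^ 2) by ring.
  rewrite H3, H; repeat split; field.
Qed.

Lemma counts_ii (lam : R) : 0 < lam ->
  portrait_counts lam (canonical form_ii 0 (-3)) 8 2 /\
  portrait_counts lam (canonical form_ii 0 0) 9 3 /\
  portrait_counts lam (canonical form_ii 2 0) 9 2 /\
  portrait_counts lam (canonical form_ii 0 (-1)) 10 4 /\
  portrait_counts lam (canonical form_ii 0 1) 10 3 /\
  portrait_counts lam (canonical form_ii 0 (-5)) 10 2.
Proof.
  intros Hlam; destruct cos30_spec as [_ Hh].
  assert (H := fun q1 q2 ir ic => boundary_flow_counts lam _ _ _ ir ic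
    (canonical_homogeneous form_ii q1 q2) Hlam (boundary_flow_ii lam q1 q2)).
  split; [|split; [|split; [|split; [|split]]]].
  1: apply (H _ _ 1%nat 0%nat). 3: apply (H _ _ 2%nat 0%nat).
  5: apply (H _ _ 1%nat 1%nat). 7: apply (H _ _ 3%nat 0%nat).
  9: apply (H _ _ 2%nat 1%nat). 11: apply (H _ _ 1%nat 2%nat).
  all: cbn [filter]; unfold inward;
    match goal with |- context [canonical form_ii ?q1 ?q2] =>
      destruct (radial_ii q1 q2) as (E1 & E2 & E3 & E4 & E5 & E6) end;
    rewrite ?E1, ?E2, ?E3, ?E4, ?E5, ?E6;
    repeat (destruct Rlt_dec; try lra); reflexivity.
Qed.

(** * Sixteen inequivalent portraits *)

Lemma inward_connection_from_infinity (lam : R) (Q : R * R -> R * R) (a : R * R * R) (d : R * R) :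
  homogeneous_quadratic Q -> radial Q d < 0 -> connection lam Q a (at_infinity d) ->
  snd a = 0.
Proof.
  intros HQ HF Hc.
  destruct (connection_solution _ _ _ _ Hc) as (g & Hg & Ha & Hl).
  assert (Hw := inward_target_at_infinity lam Q g d HQ Hg HF Hl).
  apply (filterlim_locally_unique (V := R_NormedModule) (F := Rbar_locally m_infty)
    (fun t => snd (g t))).
  - apply (filterlim_comp _ _ _ g (fun m => snd m) _ (locally a)); [exact Ha|apply continuous_w].
  - apply filterlim_ext with (fun _ : R => 0); [intros; now rewrite Hw|apply filterlim_const].
Qed.

(** The point [(-1, 0)] at infinity is a saddle entered from [(0, 1)] and
    [(0, -1)] along the circle, while the only source is the origin. *)
Lemma branching_iii_1_0 (lam : R) : 0 < lam ->
  branching lam (canonical form_iii 1 0) (at_infinity (-1, 0)).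
Proof.
  intros Hlam; assert (HQ := canonical_homogeneous form_iii 1 0).
  destruct (arcs_iii lam 1 0) as (_ & A2 & _ & A4); split.
  - intros a Ha Hs.
    apply (sources lam _ _ _ a HQ Hlam (boundary_flow_iii lam 1 0)) in Hs.
    apply inward_connection_from_infinity in Ha; [|exact HQ|rewrite radial_canonical; simpl; lra].
    cbn [filter] in Hs; unfold inward in Hs; rewrite radial_canonical in Hs.
    cbn [fst snd canonical_F] in Hs; destruct Rlt_dec; [lra|].
    destruct Hs as [<-|[]]; simpl in Ha; lra.
  - exists (at_infinity (0, 1)), (at_infinity (0, -1)); repeat split; try apply A2;
      try apply A4.
    intros E; apply at_infinity_inj in E; injection E; lra.
Qed.

(** The flow at infinity of [form_iii] is [u' = - 3 u ^ 2 v ^ 2], and the sign of [v]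
    is invariant: a trajectory tending to [(0, 1)] stays in the first quadrant. *)
Lemma target_iii_inward (lam q1 q2 : R) (a : R * R * R) :
  0 < lam -> q2 < 0 ->
  connection lam (canonical form_iii q1 q2) a (at_infinity (0, 1)) ->
  a = at_infinity (1, 0).
Proof.
  intros Hlam Hq2 Hc; assert (HQ := canonical_homogeneous form_iii q1 q2).
  assert (HF : radial (canonical form_iii q1 q2) (0, 1) < 0)
    by (rewrite radial_canonical; simpl; lra).
  assert (Ha0 := inward_connection_from_infinity _ _ _ _ HQ HF Hc).
  destruct (connection_solution _ _ _ _ Hc) as (g & Hg & Ha & Hl).
  assert (Hw := inward_target_at_infinity _ _ g _ HQ Hg HF Hl).
  assert (Hs := solution_at_infinity _ _ g Hg Hw).
  set (u := fun t => fst (fst (g t))). set (v := fun t => snd (fst (g t))).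
  assert (Huv : forall t, u t ^ 2 + v t ^ 2 = 1 /\
    is_derive u t (- v t * (3 * u t ^ 2 * v t)) /\
    is_derive v t (u t * (3 * u t ^ 2 * v t))).
  { intros t; destruct (Hs t) as (x & y & E & Hxy & Dx & Dy).
    rewrite calG_canonical in Dx, Dy.
    unfold u, v; rewrite E; cbn [fst snd]; auto. }
  clear Hs.
  assert (Hu : forall t, 0 <= u t).
  { intros t; apply Ropp_le_cancel; rewrite Ropp_0.
    apply (increasing_le_limit (fun t => - u t) (fun t => v t * (3 * u t ^ 2 * v t)) (t - 1));
      [| | |lra].
    - intros r; destruct (Huv r) as (_ & D & _).
      replace (v r * _) with (- (- v r * (3 * u r ^ 2 * v r))) by ring.
      now apply (is_derive_opp u).
    - intros r _; generalize (pow2_ge_0 (u r * v r)); lra.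
    - replace 0 with (- fst (fst (at_infinity (0, 1)))) by (simpl; ring).
      apply (filterlim_comp _ _ _ g (fun m => - fst (fst m)) _ (locally (at_infinity (0, 1))));
        [exact Hl|].
      apply (continuous_opp (V := R_NormedModule) (fun m => fst (fst m))), continuous_u. }
  destruct (eventually_positive _ g _ (fun m => snd (fst m)) Hl) as [T HT];
    [apply continuous_v|simpl; lra|].
  assert (Hv : forall t, 0 < v t).
  { apply (nonvanishing_positive v (T + 1)); [| |apply HT; lra].
    - intros t; apply (ex_derive_continuous (V := R_NormedModule)).
      eexists; apply (Huv t).
    - intros t Ht.
      assert (H0 : v (T + 1) = 0).
      { apply (vanishing_everywhere v (fun t => u t * (3 * u t ^ 2 * v t)) 3 t);
          [intros r; apply (Huv r)| |exact Ht].
        intros r; replace (_ * (_ * _)) with (3 * u r ^ 3 * v r) by ring.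
        rewrite Rabs_mult; apply Rmult_le_compat_r; [apply Rabs_pos|].
        destruct (Huv r) as [H1 _]; assert (H2 := Hu r).
        assert (u r <= 1) by nra.
        assert (0 <= u r ^ 2 <= 1) by nra.
        apply Rabs_le; simpl in *; nra. }
      generalize (HT (T + 1)); unfold v in H0; rewrite H0; lra. }
  (* The signs of [u] and [v] pass to the limit in the past. *)
  assert (Hlim : forall phi : R * R * R -> R, continuous phi a ->
    (forall t, phi (g t) <= 0) -> phi a <= 0).
  { intros phi Hphi Hneg; apply Rnot_lt_le; intros H.
    destruct (eventually_positive _ g _ phi Ha Hphi H) as [T' HT'].
    generalize (HT' (T' - 1)) (Hneg (T' - 1)); lra. }
  assert (Hau : - fst (fst a) <= 0).
  { apply (Hlim (fun m => - fst (fst m))).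
    - apply (continuous_opp (V := R_NormedModule) (fun m => fst (fst m))), continuous_u.
    - intros t; generalize (Hu t); unfold u; lra. }
  assert (Hav : - snd (fst a) <= 0).
  { apply (Hlim (fun m => - snd (fst m))).
    - apply (continuous_opp (V := R_NormedModule) (fun m => snd (fst m))), continuous_v.
    - intros t; generalize (Hv t); unfold v; lra. }
  destruct Hc as (Hne & Hea & _).
  apply equilibria in Hea as [->|[(d & Hd & ->)|(d & Hd & HFd & ->)]]; auto.
  - simpl in Ha0; lra.
  - apply (boundary_flow_iii lam q1 q2) in Hd.
    destruct Hd as [<-|[<-|[<-|[<-|[]]]]]; simpl in Hau, Hav; try lra; [reflexivity|].
    now destruct Hne.
  - generalize (finite_equilibrium_height lam _ d Hlam HFd); lra.
Qed.

(** The origin is a source connected to all other equilibria except the point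
    [(0, 1)] at infinity, which is entered from [(1, 0)] only. *)
Lemma not_branching_iii_0_m1 (lam : R) (m : R * R * R) : 0 < lam ->
  ~ branching lam (canonical form_iii 0 (-1)) m.
Proof.
  intros Hlam (Hs & a & b & Hab & Ha & Hb).
  assert (HQ := canonical_homogeneous form_iii 0 (-1)).
  assert (Ho : source lam (canonical form_iii 0 (-1)) origin)
    by (apply (sources lam _ _ _ origin HQ Hlam (boundary_flow_iii lam _ _)); now left).
  destruct (proj1 (equilibria _ _ m HQ Hlam) (proj1 (proj2 (proj2 Ha))))
    as [->|[(d & Hd & ->)|(d & Hd & HF & ->)]].
  - now apply (origin_not_target lam (canonical form_iii 0 (-1)) a).
  - destruct (Rlt_or_le (radial (canonical form_iii 0 (-1)) d) 0) as [HF|HF].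
    + apply (boundary_flow_iii lam) in Hd.
      destruct Hd as [<-|[<-|[<-|[<-|[]]]]]; rewrite radial_canonical in HF;
        simpl in HF; try lra.
      apply Hab; transitivity (at_infinity (1, 0));
        [|symmetry]; apply (target_iii_inward lam 0 (-1)); auto; lra.
    + now apply (Hs origin); [apply ray_connection_infinity|].
  - now apply (Hs origin); [apply ray_connection_finite|].
Qed.

(** For [form_v], [calG] vanishes: the whole circle at infinity consists of
    equilibria. *)
Lemma infinitely_many_equilibria_v (lam q1 q2 : R) (n : nat) :
  ~ has_cardinal (equilibrium lam (canonical form_v q1 q2)) n.
Proof.
  intros (l & Hl & Hn & Hin).
  set (e := fun k => at_infinity (/ INR (S k), sqrt (1 - (/ INR (S k)) ^ 2))).
  assert (Hk : forall k, 0 < / INR (S k) <= 1).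
  { intros k; assert (H : 1 <= INR (S k)) by (rewrite S_INR; generalize (pos_INR k); lra).
    split; [apply Rinv_0_lt_compat; lra|].
    rewrite <- Rinv_1; apply Rinv_le_contravar; lra. }
  assert (H : (length (map e (seq 0 (S n))) <= length l)%nat).
  { apply NoDup_incl_length.
    - apply NoDup_map_NoDup_ForallPairs; [|apply seq_NoDup].
      intros k k' _ _ E; apply at_infinity_inj in E; injection E as E _.
      change (/ INR (S k) = / INR (S k')) in E; apply Rinv_eq_reg, INR_eq in E; congruence.
    - intros m Hm; apply in_map_iff in Hm as (k & <- & _).
      apply Hin, equilibrium_at_infinity; split; cbn [fst snd].
      + specialize (Hk k); rewrite pow2_sqrt by nra; ring.
      + rewrite calG_canonical; reflexivity. }
  rewrite length_map, length_seq in H; lia.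
Qed.

(** Fields with finitely many equilibria, with the numbers of equilibria and of
    sources.  The parameters realise the signs of the radial part in the zero
    directions: [q2] in [form_iv]; [q1], and [q2 = 0] or not, in [form_iii]; and in
    [form_ii] the six patterns of three signs that are compatible with the sum
    [-3].  The numbers distinguish all but the last two entries. *)
Definition chosen_portraits : list (form * R * R * (nat * nat)) :=
  [ (form_iv, 0, 0, (3, 1)%nat); (form_iv, 0, 1, (4, 2)%nat); (form_iv, 0, -1, (4, 1)%nat);
    (form_iii, 0, 0, (5, 1)%nat); (form_iii, -1, 0, (6, 2)%nat);
    (form_iii, -1, -1, (7, 2)%nat); (form_iii, 1, -1, (7, 1)%nat);
    (form_ii, 0, -3, (8, 2)%nat); (form_ii, 0, 0, (9, 3)%nat); (form_ii, 2, 0, (9, 2)%nat);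
    (form_ii, 0, -1, (10, 4)%nat); (form_ii, 0, 1, (10, 3)%nat); (form_ii, 0, -5, (10, 2)%nat);
    (form_iii, 1, 0, (6, 1)%nat); (form_iii, 0, -1, (6, 1)%nat) ].

(** The default value serves as entry number 15, with infinitely many
    equilibria. *)
Definition chosen_portrait (i : nat) : form * R * R * (nat * nat) :=
  nth i chosen_portraits (form_v, 1, 0, (0, 0)%nat).

Definition chosen_form (i : nat) : form := fst (fst (fst (chosen_portrait i))).
Definition chosen_q1 (i : nat) : R := snd (fst (fst (chosen_portrait i))).
Definition chosen_q2 (i : nat) : R := snd (fst (chosen_portrait i)).
Definition chosen_field (i : nat) : R * R -> R * R :=
  canonical (chosen_form i) (chosen_q1 i) (chosen_q2 i).

Lemma chosen_counts (lam : R) (i : nat) : 0 < lam -> (i < 15)%nat ->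
  portrait_counts lam (chosen_field i)
    (fst (snd (chosen_portrait i))) (snd (snd (chosen_portrait i))).
Proof.
  intros Hlam Hi.
  destruct (counts_iv lam Hlam) as (? & ? & ?).
  destruct (counts_iii lam Hlam) as (? & ? & ? & ? & ? & ?).
  destruct (counts_ii lam Hlam) as (? & ? & ? & ? & ? & ?).
  do 15 (destruct i as [|i]; [assumption|]); lia.
Qed.

Lemma chosen_counts_distinct (i j : nat) : (i < j < 15)%nat ->
  snd (chosen_portrait i) = snd (chosen_portrait j) -> i = 13%nat /\ j = 14%nat.
Proof.
  intros Hij.
  do 15 (destruct i as [|i];
    [do 15 (destruct j as [|j]; [solve [lia | discriminate | auto]|]); lia|]); lia.
Qed.

Lemma chosen_inequivalent (lam : R) (i j : nat) : 0 < lam -> (i < j < 16)%nat ->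
  ~ topologically_equivalent lam (chosen_field i) lam (chosen_field j).
Proof.
  intros Hlam Hij He.
  destruct (chosen_counts lam i Hlam ltac:(lia)) as [Hn Hs].
  destruct (PeanoNat.Nat.eq_dec j 15) as [->|Hj].
  - destruct (finite_equilibria_invariant _ _ _ _ _ He Hn) as [n H].
    exact (infinitely_many_equilibria_v lam 1 0 n H).
  - destruct (chosen_counts lam j Hlam ltac:(lia)) as [Hn' Hs'].
    destruct (chosen_counts_distinct i j) as [-> ->]; [lia| |].
    { rewrite (surjective_pairing (snd (chosen_portrait i))).
      rewrite (surjective_pairing (snd (chosen_portrait j))).
      f_equal; [eapply cardinal_equilibria_invariant|eapply cardinal_sources_invariant];
        eassumption. }
    destruct (topologically_equivalent_conjugation _ _ _ _ He) as (h & h' & Hc & Hc').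
    apply (not_branching_iii_0_m1 lam (h (at_infinity (-1, 0))) Hlam).
    apply (conjugation_branching _ _ _ _ _ _ _ Hc Hc'), branching_iii_1_0, Hlam.
Qed.

Lemma chosen_nonzero (i : nat) : nonzero_field (chosen_field i).
Proof.
  assert (H : (exists q1 q2, chosen_field i = canonical form_iii q1 q2) \/
    exists q1 q2, chosen_field i = canonical form_v 1 0 \/
      chosen_field i = canonical form_ii q1 q2 \/ chosen_field i = canonical form_iv q1 q2).
  { unfold chosen_field, chosen_form, chosen_q1, chosen_q2, chosen_portrait.
    do 15 (destruct i as [|i]; [simpl; eauto 10|]).
    right; exists 0, 0; left; destruct i; reflexivity. }
  destruct H as [(q1 & q2 & ->)|(q1 & q2 & [-> |[-> | ->]])].
  - exists (1, 1); simpl; intros E; injection E; intros; lra.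
  - exists (1, 0); simpl; intros E; injection E; intros; lra.
  - exists (1, 0); simpl; intros E; injection E; intros; lra.
  - exists (1, 0); simpl; intros E; injection E; intros; lra.
Qed.

Theorem proposition6p2 :
  (forall (Q : R * R -> R * R) (lam : R),
     homogeneous_quadratic Q -> nonzero_field Q -> lam <> 0 ->
     exists! f : form,
       exists q1 q2 lam' : R,
         0 < lam' * lam /\
         linearly_transformable (system lam Q)
                                (system lam' (canonical f q1 q2)))
  /\
  (forall (f : form) (q1 q2 x y : R),
     calG (canonical f q1 q2) x y = canonical_G f x y /\
     calF (canonical f q1 q2) x y = canonical_F f q1 q2 x y)
  /\
  (forall lam : R, 0 < lam ->
     exists (f : nat -> form) (q1 q2 : nat -> R),
       (forall i : nat, (i < 16)%nat ->
          nonzero_field (canonical (f i) (q1 i) (q2 i))) /\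
       (forall i j : nat, (i < 16)%nat -> (j < 16)%nat -> i <> j ->
          ~ topologically_equivalent
              lam (canonical (f i) (q1 i) (q2 i))
              lam (canonical (f j) (q1 j) (q2 j)))).
Proof.
  split; [|split].
  - intros Q lam HQ _; now apply canonical_form_exists_unique.
  - intros f q1 q2 x y; split; [apply calG_canonical|apply calF_canonical].
  - intros lam Hlam; exists chosen_form, chosen_q1, chosen_q2; split.
    + intros i _; apply chosen_nonzero.
    + intros i j Hi Hj Hij He.
      destruct (PeanoNat.Nat.lt_gt_cases i j) as [H _].
      destruct (H Hij) as [Hlt|Hlt].
      * apply (chosen_inequivalent lam i j Hlam); [lia|exact He].
      * apply (chosen_inequivalent lam j i Hlam); [lia|].
        now apply topologically_equivalent_sym.
Qed.
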